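(* Let $(M,\omega,J)$ be a $2n$-dimensional toric variety determined by a Delzant polytope $P$, with moment map $\mu: M\to P\subset\mathfrak t^*$ for the $T^n$-action. Let $K\subset T^n$ be a $k$-dimensional subtorus, let $Q=T^n/K$ with a fixed splitting $i_Q:Q\hookrightarrow T^n$, let $\phi:\mathfrak t_Q^*\to\mathbb R$ be a strictly convex smooth function (with everywhere positive definite Hessian), $\varphi=\phi\circ\mu_Q$, and $X_\varphi$ the Hamiltonian vector field of $\varphi$. Let $\mathcal P_{K,t}=e^{-it\mathcal L_{X_\varphi}}\mathcal P_K$ for $t\ge0$, and let $\mathcal P_{\mathbb R}$ be the real polarization associated with the $T^n$-action. Then $$\lim_{t\to\infty}\mathcal P_{K,t}=\mathcal P_{\mathbb R},$$ i.e. for every $x\in M$, $(\mathcal P_{K,t})_x\to(\mathcal P_{\mathbb R})_x$ in the Grassmannian of $n$-dimensional complex subspaces of $T_xM\otimes\mathbb C$.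
   Context: Setting. $(M,\omega)$ is the compact symplectic toric manifold of the Delzant polytope $P\subset\mathfrak t^*$, $J$ is a compatible $T^n$-invariant complex structure, and $\mathcal P_J\subset TM\otimes\mathbb C$ is the Kähler polarization given by the $(0,1)$-vectors of $J$. $\rho$ and $\rho_K$ are the actions of $T^n$ and $K$; $\mu_K=i_K^*\circ\mu:M\to\mathfrak t_K^*$ and $\mu_Q=i_Q^*\circ\mu:M\to\mathfrak t_Q^*$, where $i_K^*:\mathfrak t^*\to\mathfrak t_K^*$, $i_Q^*:\mathfrak t^*\to\mathfrak t_Q^*$ are the natural projections. $\operatorname{Im}d\rho$ (resp. $\operatorname{Im}d\rho_K$) is the span of the fundamental vector fields $\xi^\#$ with $\xi\in\mathfrak t$ (resp. $\xi\in\mathfrak t_K$); $\xi^\#$ is the Hamiltonian vector field of $\langle\mu,\xi\rangle$. For a complex-valued function $f$, $X_f$ is its (complex) Hamiltonian vector field (sign convention $\iota_{X_f}\omega=-df$). Define $$\mathcal P_K=\bigl((\ker d\mu_K\otimes\mathbb C)\cap\mathcal P_J\bigr)\oplus(\operatorname{Im}d\rho_K\otimes\mathbb C),\qquad \mathcal P_{\mathbb R}=\bigl((\ker d\mu\otimes\mathbb C)\cap\mathcal P_J\bigr)\oplus(\operatorname{Im}d\rho\otimes\mathbb C).$$ Imaginary-time flow. For a function $f$ put $f^t:=e^{-itX_\varphi}f=\sum_{r\ge0}\frac{1}{r!}(-itX_\varphi)^rf$. For a complex vector field $V$, $e^{-it\mathcal L_{X_\varphi}}V=\sum_{r\ge 0}\frac{(-it)^r}{r!}\mathcal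 L_{X_\varphi}^rV$; in particular $e^{-it\mathcal L_{X_\varphi}}X_f=X_{f^t}$, and fundamental vector fields are fixed. The distribution $\mathcal P_{K,t}=e^{-it\mathcal L_{X_\varphi}}\mathcal P_K$ is defined pointwise as follows. Given $x\in M$, let $l$ be the dimension of the $T^n$-stabilizer of $x$ and $p$ the dimension of the $K$-orbit of $x$. By the holomorphic slice theorem there is a $T^n$-equivariant biholomorphism from a $T^n$-invariant neighbourhood of $x$ onto a $T^n$-invariant open subset of $(\mathbb C^* )^{n-l}\times\mathbb C^l$ with coordinates $(w_1,\dots,w_{n-l},z_1,\dots,z_l)$, where $T^n$ acts diagonally by characters, $x$ corresponds to a point with $z=0$, and the coordinates are chosen so that $w_{p+1},\dots,w_{n-l}$ are $K$-invariant. Then $$(\mathcal P_K)_x=\operatorname{Span}_{\mathbb C}\{\xi^\#(x)\ (\xi\in\mathfrak t_K),\ X_{w_j}(x)\ (p<j\le n-l),\ X_{z_k}(x)\ (1\le k\le l)\},$$ and applying $e^{-it\mathcal L_{X_\varphi}}$ to this frame, $$(\mathcal P_{K,t})_x=\operatorname{Span}_{\mathbb C}\{\xi^\#(x)\ (\xi\in\mathfrak t_K),\ X_{w_j^t}(x)\ (p<j\le n-l),\ X_{z_k^t}(x)\ (1\le k\le l)\}.$$ *)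

(* Defs.v *)
From mathcomp Require Import all_boot all_order all_algebra.
From mathcomp Require Import all_classical all_reals all_analysis.
From mathcomp Require Import complex.

Set Implicit Arguments.
Unset Strict Implicit.
Unset Printing Implicit Defensive.

Import Order.TTheory GRing.Theory Num.Theory.
Import numFieldNormedType.Exports.

Local Open Scope classical_set_scope.
Local Open Scope ring_scope.

(* Vectors are rows and linear maps act on the right: the matrix of a linear
   map f has the rows f(e_i), so that f(v) = v *m f. *)

Definition toC (R : realType) (a b : nat) (A : 'M[R]_(a, b)) : 'M[R[i]]_(a, b) :=
  map_mx (real_complex R) A.

Definition intM (R : realType) (a b : nat) (A : 'M[int]_(a, b)) : 'M[R]_(a, b) :=
  map_mx intr A.

Definition pairing (R : realType) (n : nat) (u v : 'rV[R]_n) : R :=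
  (u *m v^T) 0 0.

Definition basis_vec (R : realType) (m : nat) (i : 'I_m) : 'rV[R]_m :=
  delta_mx 0 i.

Fixpoint iter_derive (R : realType) (V W : normedModType R) (vs : seq V)
    (f : V -> W) : V -> W :=
  if vs is v :: vs' then fun x => 'D_v (iter_derive vs' f) x else f.

(* Only used with U open. *)
Definition smooth_on (R : realType) (V W : normedModType R) (U : set V)
    (f : V -> W) : Prop :=
  forall (vs : seq V) (x : V), U x -> differentiable (iter_derive vs f) x.

(* [cinv] is a total function; only its values on the image of [cdom] matter. *)
Record chart (R : realType) (M : topologicalType) (m : nat) := Chart {
  cdom : set M;
  cmap :> M -> 'rV[R]_m;
  cinv : 'rV[R]_m -> M;
  cdom_open : open cdom;
  cimg_open : open (cmap @` cdom);
  cmap_continuous : forall y, cdom y -> {for y, continuous cmap};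
  cinv_continuous : forall u, (cmap @` cdom) u -> {for u, continuous cinv};
  cmapK : forall y, cdom y -> cinv (cmap y) = y }.

(* The tangent space T_yM is R^m, a vector standing for its coordinates in the
   preferred chart [chart_at y]. *)
Record smooth_atlas (R : realType) (M : topologicalType) (m : nat) :=
  SmoothAtlas {
  atlas : set (chart R M m);
  chart_at : M -> chart R M m;
  chart_at_atlas : forall y, atlas (chart_at y);
  mem_chart_at : forall y, cdom (chart_at y) y;
  atlas_smooth : forall c c', atlas c -> atlas c' ->
    smooth_on (c @` (cdom c `&` cdom c')) (c' \o cinv c) }.

Definition compatible_chart (R : realType) (M : topologicalType) (m : nat)
    (A : smooth_atlas R M m) (S : chart R M m) : Prop :=
  forall c, atlas A c ->
    smooth_on (c @` (cdom c `&` cdom S)) (S \o cinv c) /\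
    smooth_on (S @` (cdom c `&` cdom S)) (c \o cinv S).

Definition smooth_map (R : realType) (M : topologicalType) (m : nat)
    (A : smooth_atlas R M m) (W : normedModType R) (f : M -> W) : Prop :=
  forall c, atlas A c -> smooth_on (c @` cdom c) (f \o cinv c).

Definition dvec (R : realType) (M : topologicalType) (m b : nat)
    (A : smooth_atlas R M m) (f : M -> 'rV[R]_b) (y : M) : 'M[R]_(m, b) :=
  jacobian (f \o cinv (chart_at A y)) (chart_at A y y).

Definition dfun (R : realType) (M : topologicalType) (m : nat)
    (A : smooth_atlas R M m) (f : M -> R) (y : M) : 'rV[R]_m :=
  \row_i 'D_(basis_vec R i) (f \o cinv (chart_at A y)) (chart_at A y y).

Definition dfunC (R : realType) (M : topologicalType) (m : nat)
    (A : smooth_atlas R M m) (f : M -> R[i]) (y : M) : 'rV[R[i]]_m :=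
  \row_i (dfun A (fun z => complex.Re (f z)) y 0 i
          +i* dfun A (fun z => complex.Im (f z)) y 0 i)%C.

Definition tangent_map (R : realType) (M : topologicalType) (m : nat)
    (A : smooth_atlas R M m) (F : M -> M) (y : M) : 'M[R]_m :=
  dvec A (chart_at A (F y) \o F) y.

(* omega_y(u, v) = u *m omega y *m v^T *)

(* The rows of [invmx (dvec A c y)] are the coordinate vector fields of c. *)
Definition form_in_chart (R : realType) (M : topologicalType) (m : nat)
    (A : smooth_atlas R M m) (omega : M -> 'M[R]_m) (c : chart R M m)
    (u : 'rV[R]_m) : 'M[R]_m :=
  let E := invmx (dvec A c (cinv c u)) in E *m omega (cinv c u) *m E^T.

Record symplectic_form (R : realType) (M : topologicalType) (m : nat)
    (A : smooth_atlas R M m) (omega : M -> 'M[R]_m) : Prop := SymplecticForm {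
  form_alternating : forall y, (omega y)^T = - omega y;
  form_nondegenerate : forall y, omega y \in unitmx;
  form_smooth : forall c, atlas A c -> forall i j : 'I_m,
    smooth_on (c @` cdom c) (fun u => form_in_chart A omega c u i j);
  form_closed : forall c, atlas A c -> forall u, (c @` cdom c) u ->
    forall i j k : 'I_m,
      'D_(basis_vec R i) (fun u' => form_in_chart A omega c u' j k) u
    + 'D_(basis_vec R j) (fun u' => form_in_chart A omega c u' k i) u
    + 'D_(basis_vec R k) (fun u' => form_in_chart A omega c u' i j) u = 0 }.

(* Multiplication by i on R^n x R^n = C^n: (a, b) |-> (- b, a). *)
Definition std_complex (R : realType) (n : nat) : 'M[R]_(n + n) :=
  block_mx 0 1%:M (- 1%:M) 0.

Definition ccoord (R : realType) (M : topologicalType) (n : nat)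
    (S : chart R M (n + n)) (j : 'I_n) (y : M) : R[i] :=
  (S y 0 (lshift n j) +i* S y 0 (rshift n j))%C.

Definition holomorphic_chart (R : realType) (M : topologicalType) (n : nat)
    (A : smooth_atlas R M (n + n)) (J : M -> 'M[R]_(n + n))
    (S : chart R M (n + n)) : Prop :=
  compatible_chart A S /\
  forall y, cdom S y -> J y *m dvec A S y = dvec A S y *m std_complex R n.

(* An integrable almost complex structure (smoothness of J follows from the
   existence of holomorphic charts). *)
Definition complex_structure (R : realType) (M : topologicalType) (n : nat)
    (A : smooth_atlas R M (n + n)) (J : M -> 'M[R]_(n + n)) : Prop :=
  (forall y, J y *m J y = - 1%:M) /\
  (forall y, exists2 S, holomorphic_chart A J S & cdom S y).

(* omega(., J .) is a Riemannian metric. *)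
Definition compatible_structure (R : realType) (M : topologicalType) (m : nat)
    (omega J : M -> 'M[R]_m) : Prop :=
  (forall y, J y *m omega y *m (J y)^T = omega y) /\
  (forall y (v : 'rV[R]_m), v != 0 ->
    0 < (v *m omega y *m (v *m J y)^T) 0 0).

(* The Hamiltonian vector field of a function with differential alpha:
   omega(X, v) = - alpha(v) for all v. *)
Definition ham (R : realType) (M : topologicalType) (m : nat)
    (omega : M -> 'M[R]_m) (alpha : 'rV[R]_m) (y : M) : 'rV[R]_m :=
  - alpha *m invmx (omega y).

Definition hamC (R : realType) (M : topologicalType) (m : nat)
    (omega : M -> 'M[R]_m) (alpha : 'rV[R[i]]_m) (y : M) : 'rV[R[i]]_m :=
  - alpha *m invmx (toC (omega y)).

(* The torus is T^n = t / Lambda with t = R^n and Lambda = 2 pi Z^n; an action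
   of T^n is written as an action of t in which Lambda acts trivially. *)
Definition period (R : realType) (n : nat) (v : 'rV[int]_n) : 'rV[R]_n :=
  (2 * pi) *: intM R v.

Record torus_action (R : realType) (M : topologicalType) (m n : nat)
    (A : smooth_atlas R M m) (rho : 'rV[R]_n -> M -> M) : Prop := TorusAction {
  act0 : forall y, rho 0 y = y;
  actD : forall a b y, rho (a + b) y = rho a (rho b y);
  act_period : forall v y, rho (period R v) y = y;
  act_continuous : continuous (fun p : 'rV[R]_n * M => rho p.1 p.2);
  act_smooth : forall c c', atlas A c -> atlas A c' ->
    smooth_on [set p : 'rV[R]_n * 'rV[R]_m |
                 (c @` cdom c) p.2 /\ cdom c' (rho p.1 (cinv c p.2))]
      (fun p => c' (rho p.1 (cinv c p.2))) }.

Definition effective_action (R : realType) (M : Type) (n : nat)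
    (rho : 'rV[R]_n -> M -> M) : Prop :=
  forall a, (forall y, rho a y = y) -> exists v, a = period R v.

(* xi^#(y) = xi *m fund y for xi in t. *)
Definition fund (R : realType) (M : topologicalType) (m n : nat)
    (A : smooth_atlas R M m) (rho : 'rV[R]_n -> M -> M) (y : M) :
    'M[R]_(n, m) :=
  jacobian (fun a => chart_at A y (rho a y)) 0.

(* t^* = R^n through [pairing]; [moment_eq] reads
   omega(xi^#, v) = - d<mu, xi>(v). *)
Record moment_map (R : realType) (M : topologicalType) (m n : nat)
    (A : smooth_atlas R M m) (omega : M -> 'M[R]_m)
    (rho : 'rV[R]_n -> M -> M) (mu : M -> 'rV[R]_n) : Prop := MomentMap {
  moment_smooth : smooth_map A mu;
  moment_invariant : forall a y, mu (rho a y) = mu y;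
  moment_eq : forall y, fund A rho y *m omega y = - (dvec A mu y)^T }.

Definition polyhedron (R : realType) (n d : nat) (u : 'I_d -> 'rV[int]_n)
    (lam : 'I_d -> R) : set 'rV[R]_n :=
  [set y | forall i, lam i <= pairing y (intM R (u i))].

Definition vertex (R : realType) (n : nat) (P : set 'rV[R]_n)
    (y : 'rV[R]_n) : Prop :=
  P y /\ forall v, P (y + v) -> P (y - v) -> v = 0.

(* At each vertex the normals of the facets through it form a Z-basis of Z^n. *)
Definition delzant (R : realType) (n : nat) (P : set 'rV[R]_n) : Prop :=
  [/\ P !=set0, compact P &
   exists (d : nat) (u : 'I_d -> 'rV[int]_n) (lam : 'I_d -> R),
     P = polyhedron u lam /\
     forall y, vertex P y -> exists s : 'I_n -> 'I_d,
       [/\ injective s,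
           forall i, (pairing y (intM R (u i)) == lam i) = (i \in codom s) &
           (\matrix_(i < n, j < n) u (s i) 0 j) \in unitmx]].

(* By Delzant's theorem these conditions determine the Hamiltonian T^n-space
   (M, omega, mu) up to isomorphism from P. *)
Record toric_variety (R : realType) (n : nat) (P : set 'rV[R]_n) :=
  ToricVariety {
  tvar :> topologicalType;
  tatlas : smooth_atlas R tvar (n + n);
  tomega : tvar -> 'M[R]_(n + n);
  tJ : tvar -> 'M[R]_(n + n);
  trho : 'rV[R]_n -> tvar -> tvar;
  tmu : tvar -> 'rV[R]_n;
  tvar_hausdorff : hausdorff_space tvar;
  tvar_compact : compact [set: tvar];
  tvar_connected : connected [set: tvar];
  tomega_symplectic : symplectic_form tatlas tomega;
  tJ_complex : complex_structure tatlas tJ;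
  tJ_compatible : compatible_structure tomega tJ;
  trho_action : torus_action tatlas trho;
  trho_effective : effective_action trho;
  tomega_invariant : forall a y,
    tangent_map tatlas (trho a) y *m tomega (trho a y)
      *m (tangent_map tatlas (trho a) y)^T = tomega y;
  tJ_invariant : forall a y,
    tJ y *m tangent_map tatlas (trho a) y
      = tangent_map tatlas (trho a) y *m tJ (trho a y);
  tmu_moment : moment_map tatlas tomega trho tmu;
  tmu_image : range tmu = P }.

Arguments tomega {R n P} t _.
Arguments tJ {R n P} t _.
Arguments trho {R n P} t _ _.
Arguments tmu {R n P} t _.

(* The rows of BK and BQ are lattice bases of K = T^k -> T^n and of the image
   of i_Q : Q = T^q -> T^n; t_K and i_Q(t_Q) are their real row spans.  The
   condition is Z^n = Lambda_K (+) Lambda_Q, i.e. T^n = K x i_Q(Q). *)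
Definition split_subtorus (n k q : nat) (BK : 'M[int]_(k, n))
    (BQ : 'M[int]_(q, n)) : Prop :=
  forall v : 'rV[int]_n, exists! ab : 'rV[int]_k * 'rV[int]_q,
    v = ab.1 *m BK + ab.2 *m BQ.

(* i_Q^* : t^* -> t_Q^*, in the basis of t_Q given by the rows of BQ. *)
Definition muQ (R : realType) (n q : nat) (P : set 'rV[R]_n)
    (X : toric_variety P) (BQ : 'M[int]_(q, n)) (y : X) : 'rV[R]_q :=
  tmu X y *m (intM R BQ)^T.

Definition strictly_convex_smooth (R : realType) (q : nat)
    (phi : 'rV[R]_q -> R) : Prop :=
  [/\ smooth_on setT phi,
      forall (u v : 'rV[R]_q) (s : R), u != v -> 0 < s -> s < 1 ->
        phi (s *: u + (1 - s) *: v) < s * phi u + (1 - s) * phi v &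
      forall u v : 'rV[R]_q, v != 0 -> 0 < 'D_v (fun u' => 'D_v phi u') u].

Definition limC (R : realType) (u : nat -> R[i]) : R[i] :=
  (limn (fun N => complex.Re (u N)) +i* limn (fun N => complex.Im (u N)))%C.

Definition lieC (R : realType) (M : topologicalType) (m : nat)
    (A : smooth_atlas R M m) (V : M -> 'rV[R]_m) (f : M -> R[i]) : M -> R[i] :=
  fun y => (toC (V y) *m (dfunC A f y)^T) 0 0.

(* e^{-itV} f *)
Definition imag_flow (R : realType) (M : topologicalType) (m : nat)
    (A : smooth_atlas R M m) (V : M -> 'rV[R]_m) (t : R) (f : M -> R[i]) :
    M -> R[i] :=
  fun y => limC (fun N => \sum_(0 <= r < N)
    (r`!%:R)^-1 * (- ('i * t%:C)%C) ^+ r * iter r (lieC A V) f y).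

(* The kernel of [fund] at x is the Lie algebra of the stabilizer of x. *)
Definition stab_dim (R : realType) (n : nat) (P : set 'rV[R]_n)
    (X : toric_variety P) (x : X) : nat :=
  \rank (kermx (fund (tatlas X) (trho X) x)).

(* The rows span the tangent space of the K-orbit of x. *)
Definition orbit_dim (R : realType) (n k : nat) (P : set 'rV[R]_n)
    (X : toric_variety P) (BK : 'M[int]_(k, n)) (x : X) : nat :=
  \rank (intM R BK *m fund (tatlas X) (trho X) x).

(* The complex coordinates (w_1, ..., w_{n-l}, z_1, ..., z_l) are
   [ccoord S 0, ..., ccoord S (n-1)], so that with indices from 0 the w's are
   those of index j < n - l.  The j-th one has the weight [row j slice_wt]. *)
Record slice_chart (R : realType) (n k : nat) (P : set 'rV[R]_n)
    (X : toric_variety P) (BK : 'M[int]_(k, n)) (x : X) := SliceChart {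
  slice_map :> chart R X (n + n);
  slice_wt : 'M[int]_n;
  slice_holo : holomorphic_chart (tatlas X) (tJ X) slice_map;
  slice_mem : cdom slice_map x;
  slice_invariant : forall a y, cdom slice_map y -> cdom slice_map (trho X a y);
  slice_equivariant : forall (a : 'rV[R]_n) y j, cdom slice_map y ->
    let theta := pairing a (intM R (row j slice_wt)) in
    ccoord slice_map j (trho X a y)
      = (cos theta +i* sin theta)%C * ccoord slice_map j y;
  slice_nonzero : forall y (j : 'I_n), cdom slice_map y ->
    (j < n - stab_dim x)%N -> ccoord slice_map j y != 0;
  slice_zero : forall j : 'I_n,
    (n - stab_dim x <= j)%N -> ccoord slice_map j x = 0;
  slice_K_invariant : forall (a : 'rV[R]_k) y (j : 'I_n), cdom slice_map y ->
    (orbit_dim BK x <= j)%N -> (j < n - stab_dim x)%N ->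
    ccoord slice_map j (trho X (a *m intM R BK) y) = ccoord slice_map j y }.

(* Complex subspaces of T_xM (x) C = C^(2n) are row spaces of matrices. *)

Definition X_varphi (R : realType) (n q : nat) (P : set 'rV[R]_n)
    (X : toric_variety P) (BQ : 'M[int]_(q, n)) (phi : 'rV[R]_q -> R) (y : X) :
    'rV[R]_(n + n) :=
  ham (tomega X) (dfun (tatlas X) (fun z => phi (muQ BQ z)) y) y.

(* The condition p <= j on the 0-based index selects w_{p+1}, ..., w_{n-l} and
   all of z_1, ..., z_l. *)
Definition PKt (R : realType) (n k q : nat) (P : set 'rV[R]_n)
    (X : toric_variety P) (BK : 'M[int]_(k, n)) (BQ : 'M[int]_(q, n))
    (phi : 'rV[R]_q -> R) (x : X) (S : slice_chart BK x) (t : R) :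
    'M[R[i]]_(n + n) :=
  (toC (intM R BK *m fund (tatlas X) (trho X) x)
   + \sum_(j < n | (orbit_dim BK x <= j)%N)
       <<hamC (tomega X)
           (dfunC (tatlas X)
              (imag_flow (tatlas X) (X_varphi BQ phi) t (ccoord S j)) x) x>>)%MS.

(* (ker dmu (x) C) /\ P_J + Im drho (x) C, where P_J is the (-i)-eigenspace
   of J. *)
Definition PR (R : realType) (n : nat) (P : set 'rV[R]_n)
    (X : toric_variety P) (x : X) : 'M[R[i]]_(n + n) :=
  ((kermx (toC (dvec (tatlas X) (tmu X) x))
    :&: eigenspace (toC (tJ X x)) (- 'i)%C)
   + toC (fund (tatlas X) (trho X) x))%MS.

(* Convergence, as t -> +oo, in the Grassmannian of d-dimensional subspaces of
   C^m, i.e. in the quotient of the space of d-frames by GL_d: since the quotient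
   map has continuous local sections, V t --> W iff suitable frames of V t
   converge to a frame of W. *)
Definition grass_cvg (R : realType) (m d : nat) (V : R -> 'M[R[i]]_m)
    (W : 'M[R[i]]_m) : Prop :=
  [/\ forall t, 0 <= t -> \rank (V t) = d,
      \rank W = d &
      exists (B : R -> 'M[R[i]]_(d, m)) (B0 : 'M[R[i]]_(d, m)),
        [/\ forall t, 0 <= t -> (B t :=: V t)%MS,
            (B0 :=: W)%MS,
            forall i j, complex.Re (B t i j) @[t --> +oo] --> complex.Re (B0 i j) &
            forall i j, complex.Im (B t i j) @[t --> +oo] --> complex.Im (B0 i j)]].

(* Main.v *)
Require Import Defs.
From mathcomp Require Import all_boot all_order all_algebra.
From mathcomp Require Import all_classical all_reals all_analysis.
From mathcomp Require Import complex.
From mathcomp Require Import ring lra.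

Set Implicit Arguments.
Unset Strict Implicit.
Unset Printing Implicit Defensive.

Import Order.TTheory GRing.Theory Num.Theory.
Import numFieldNormedType.Exports.

Local Open Scope classical_set_scope.
Local Open Scope ring_scope.

(* X_varphi(y) = xi(y)^# with xi = i_Q(grad phi (mu_Q)) constant along T^n-orbits,
   so a coordinate s_j of weight w_j is an eigenfunction of X_varphi with the
   invariant eigenvalue i h_j, h_j = <xi, w_j>, and s_j^t = e^{t h_j} s_j.  Up to
   the factor e^{t h_j}, the vector X_{s_j^t}(x) is X_{s_j} + t s_j Xi_j^#, where
   Xi_j = i_Q Hess(phi) i_Q^* w_j.  For the z_k, which vanish at x, the line does
   not move, and X_{z_k} lies in ker dmu and in P_J.  For the K-invariant w's it
   tends to the line of Xi_j^#.  The weights of the latter are linearly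
   independent and vanish on t_K, so by positivity of the Hessian the Xi_j^# and
   the xi^#, xi in t_K, together span the tangent space of the T^n-orbit. *)

(** * Real and imaginary parts of complex matrices *)

Section ComplexMatrices.
Context {R : realType}.
Local Notation C := R[i].

Definition re_mx a b (A : 'M[C]_(a, b)) : 'M[R]_(a, b) := map_mx (@complex.Re R) A.
Definition im_mx a b (A : 'M[C]_(a, b)) : 'M[R]_(a, b) := map_mx (@complex.Im R) A.

(** Taking real parts commutes with multiplication by a real matrix. With the analogue for imaginary
    parts, this splits a complex linear relation with real coefficients into two real ones, to which
    positivity of the Hessian can be applied. *)
Lemma re_mx_mul a b c (A : 'M[C]_(a, b)) (B : 'M[R]_(b, c)) :
  re_mx (A *m toC B) = re_mx A *m B.
Proof.
apply/matrixP => i j; rewrite !mxE.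
rewrite (big_morph (@complex.Re R) (id1 := 0) (op1 := +%R)) //; last by case=> ? ? [].
apply: eq_bigr => l _; rewrite !mxE; case: (A i l) => x y /=.
by rewrite mulr0 subr0.
Qed.

Lemma im_mx_mul a b c (A : 'M[C]_(a, b)) (B : 'M[R]_(b, c)) :
  im_mx (A *m toC B) = im_mx A *m B.
Proof.
apply/matrixP => i j; rewrite !mxE.
rewrite (big_morph (@complex.Im R) (id1 := 0) (op1 := +%R)) //; last by case=> ? ? [].
apply: eq_bigr => l _; rewrite !mxE; case: (A i l) => x y /=.
by rewrite mulr0 add0r.
Qed.

Lemma re_mxD a b (A B : 'M[C]_(a, b)) : re_mx (A + B) = re_mx A + re_mx B.
Proof. by apply/matrixP => i j; rewrite !mxE; case: (A i j); case: (B i j). Qed.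

Lemma im_mxD a b (A B : 'M[C]_(a, b)) : im_mx (A + B) = im_mx A + im_mx B.
Proof. by apply/matrixP => i j; rewrite !mxE; case: (A i j); case: (B i j). Qed.

Lemma re_mx0 a b : re_mx (0 : 'M[C]_(a, b)) = 0.
Proof. by apply/matrixP => i j; rewrite !mxE. Qed.

Lemma im_mx0 a b : im_mx (0 : 'M[C]_(a, b)) = 0.
Proof. by apply/matrixP => i j; rewrite !mxE. Qed.

Lemma re_im_mx0 a b (A : 'M[C]_(a, b)) : re_mx A = 0 -> im_mx A = 0 -> A = 0.
Proof.
move=> /matrixP hr /matrixP hi; apply/matrixP => i j.
by move: (hr i j) (hi i j); rewrite !mxE; case: (A i j) => x y /= -> ->.
Qed.

Lemma toCM a b c (A : 'M[R]_(a, b)) (B : 'M[R]_(b, c)) :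
  toC (A *m B) = toC A *m toC B.
Proof. exact: map_mxM. Qed.

Lemma toC_tr a b (A : 'M[R]_(a, b)) : toC A^T = (toC A)^T.
Proof. by apply/matrixP => i j; rewrite !mxE. Qed.

Lemma toCZ a b (x : R) (A : 'M[R]_(a, b)) : toC (x *: A) = x%:C%C *: toC A.
Proof. by apply/matrixP => i j; rewrite !mxE rmorphM. Qed.

End ComplexMatrices.

(** * The linear algebra in one tangent space *)

(* At the point x: [F] is [fund], [dS] the Jacobian of the slice chart, whose
   complex coordinates s_j have the weights [row j W], and [H] is the Hessian
   of phi.  The ranks [r] and [p] are the dimensions of the orbits of T^n and
   K. *)
Section Frames.
Context {R : realType} (n k q : nat).
Local Notation C := R[i].
Local Notation N := (n + n)%N.
Context (F : 'M[R]_(n, N)) (Om J dS : 'M[R]_N) (W : 'M[R]_n).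
Context (BK : 'M[R]_(k, n)) (BQ : 'M[R]_(q, n)) (H : 'M[R]_q).
Context (s : 'I_n -> C).

Local Notation r := (\rank F).
Local Notation p := (\rank (BK *m F)).

(** The columns of [lsubmx dS] and [rsubmx dS] are the differentials of the real and imaginary parts
    of the [s j]; after transposition, row [j] is the complex covector $ds_j$. *)
Definition ds_mx : 'M[C]_(n, N) :=
  (toC (lsubmx dS) + 'i%C *: toC (rsubmx dS))^T.
Definition ham_mx : 'M[C]_(n, N) := - ds_mx *m invmx (toC Om).
(* Row j followed by [F] is the Hamiltonian vector of d<grad phi(mu_Q), w_j>. *)
Definition Xi_mx : 'M[R]_n := W *m BQ^T *m H *m BQ.

Context (dS_unit : dS \in unitmx).
Context (Om_unit : Om \in unitmx).
Context (J_sqr : J *m J = - 1%:M).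
Context (J_Om : J *m Om *m J^T = Om).
Context (J_dS : J *m dS = dS *m std_complex R n).
Context (F_dS : F *m dS =
  row_mx (W^T *m diag_mx (\row_j - complex.Im (s j)))
         (W^T *m diag_mx (\row_j complex.Re (s j)))).
Context (s_neq0 : forall j : 'I_n, (j < r)%N -> s j != 0).
Context (s_eq0 : forall j : 'I_n, (r <= j)%N -> s j = 0).
Context (BK_W : forall j : 'I_n, (p <= j)%N -> (j < r)%N -> BK *m col j W^T = 0).
Context (span_KQ : forall w : 'rV[R]_n, w *m BK^T = 0 -> w *m BQ^T = 0 -> w = 0).
Context (H_pos : forall v : 'rV[R]_q, v != 0 -> 0 < (v *m H *m v^T) 0 0).

Let p_le_r : (p <= r)%N. Proof. exact: mxrankM_maxr. Qed.
Let r_le_n : (r <= n)%N. Proof. exact: rank_leq_row. Qed.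

(** Only the weights of index below [r] contribute to [F *m dS], since the other coordinates vanish
    at the point. This product has rank [r], so these [r] weights are independent. *)
Lemma weight_free (v : 'rV[R]_n) :
  (forall j : 'I_n, (r <= j)%N -> v 0 j = 0) -> v *m W = 0 -> v = 0.
Proof.
move=> v0 vW.
pose P : 'M[R]_(r, n) := pid_mx r.
(* [P^T *m P] is the projection onto the first [r] coordinates. The function [f] will be both
   [complex.Re] and minus [complex.Im]. *)
have s0P (f : C -> R) : f 0 = 0 ->
    P^T *m P *m diag_mx (\row_j f (s j)) = diag_mx (\row_j f (s j)).
  move=> f0; rewrite tr_pid_mx mul_pid_mx !minnn.
  apply/matrixP => i j; rewrite mul_mx_diag !mxE.
  have [->|] := eqVneq i j; last by rewrite -val_eqE => /negbTE ->; rewrite mul0r mulr0n.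
  rewrite eqxx; have [jr|rj] := ltnP j r; first by rewrite mul1r.
  by rewrite s_eq0 // f0 mulr0.
have W_sub : W^T *m (P^T *m P) *m row_mx (diag_mx (\row_j - complex.Im (s j)))
    (diag_mx (\row_j complex.Re (s j))) = F *m dS.
  by rewrite -mulmxA F_dS mul_mx_row (s0P (fun z => - complex.Im z)) ?oppr0 // s0P // mul_mx_row.
have rFdS : \rank (F *m dS) = r by rewrite mxrankMfree // row_free_unit.
have rPW : (\rank (F *m dS) <= \rank (P *m W))%N.
  rewrite -W_sub -(mxrank_tr (P *m W)) trmx_mul !mulmxA -!mulmxA mulmxA.
  exact: mxrankM_maxl.
have PWfree : row_free (P *m W) by rewrite -row_leq_rank -{1}rFdS.
have vP : v = v *m P^T *m P.
  apply/rowP => j; rewrite -mulmxA tr_pid_mx mul_pid_mx !minnn.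
  rewrite !mxE (bigD1 j) //= !mxE eqxx /= big1 ?addr0; last first.
    by move=> i ij; rewrite !mxE -val_eqE /= in ij *; rewrite (negbTE ij) mulr0.
  have [jr|rj] := ltnP j r; first by rewrite mulr1.
  by rewrite mulr0 v0.
have : v *m P^T *m (P *m W) = 0 by rewrite mulmxA -vP.
move/eqP; rewrite mulmx_free_eq0 // => /eqP vP0.
by rewrite vP vP0 mul0mx.
Qed.

(** These are the Cauchy-Riemann equations for the slice coordinates. *)
Lemma J_split : J *m lsubmx dS = - rsubmx dS /\ J *m rsubmx dS = lsubmx dS.
Proof.
have := J_dS; rewrite -{1 2}(hsubmxK dS) mul_mx_row /std_complex mul_row_block.
by case/eq_row_mx => -> ->; rewrite !mulmx0 mulmx1 mulmxN mulmx1 add0r addr0.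
Qed.

(** The $ds_j$ are of type (1,0), by the Cauchy-Riemann equations. *)
Lemma ds_mxJ : ds_mx *m (toC J)^T = 'i%C *: ds_mx.
Proof.
have [Jl Jr] := J_split.
rewrite -trmx_mul mulmxDr -scalemxAr -!toCM Jl Jr /ds_mx -linearZ /=.
congr _^T; rewrite scalerDr scalerA -expr2 sqr_i scaleN1r addrC.
by rewrite /toC map_mxN.
Qed.

(** Already the real part of $\sum_j c_j\,ds_j$ determines [c]: its coefficients in the basis formed
    by the columns of [dS] are the real parts and minus the imaginary parts of the $c_j$. *)
Lemma ds_mx_free : row_free ds_mx.
Proof.
apply/inj_row_free => c c0.
have : row_mx (re_mx c) (- im_mx c) *m dS^T = 0.
  rewrite -(hsubmxK dS) tr_row_mx mul_row_col.
  have <- : re_mx (c *m ds_mx) = re_mx c *m (lsubmx dS)^T + - im_mx c *m (rsubmx dS)^T.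
    rewrite /ds_mx linearD linearZ /= -!toC_tr.
    rewrite mulmxDr -scalemxAr scalemxAl.
    rewrite re_mxD !re_mx_mul; congr (_ + _ *m _).
    apply/matrixP => i j; rewrite !mxE; case: (c i j) => x y /=.
    by rewrite mul0r mul1r sub0r.
  by rewrite c0 re_mx0.
move/eqP; rewrite mulmx_free_eq0 ?row_free_unit ?unitmx_tr // => /eqP.
rewrite -[0]row_mx0 => /eq_row_mx [re0 /eqP im0].
by apply: re_im_mx0 => //; apply/eqP; rewrite -oppr_eq0.
Qed.

Lemma toC_unit : toC Om \in unitmx.
Proof. by rewrite /toC map_unitmx. Qed.

Lemma ham_mx_free : row_free ham_mx.
Proof.
rewrite /ham_mx /row_free mxrankMfree ?row_free_unit ?unitmx_inv ?toC_unit //.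
by rewrite mxrank_opp; exact: ds_mx_free.
Qed.

Lemma toC_J_Om : toC J *m toC Om = - (toC Om *m (toC J)^T).
Proof.
have JJ : toC J *m toC J = - 1%:M by rewrite -toCM J_sqr /toC map_mxN map_scalar_mx rmorph1.
rewrite -[in LHS]J_Om !toCM toC_tr !mulmxA JJ.
by rewrite !mulNmx mul1mx.
Qed.

(** Invariance of the form under [J] exchanges the types: a covector of type (1,0) has a Hamiltonian
    vector of type (0,1), so each $X_{s_j}$ lies in $\mathcal P_J$. *)
Lemma ham_mxJ : ham_mx *m toC J = - 'i%C *: ham_mx.
Proof.
have key : invmx (toC Om) *m toC J = - (toC J)^T *m invmx (toC Om).
  rewrite -[LHS](mulmxK toC_unit) -[X in X *m _]mulmxA toC_J_Om mulmxN.
  by rewrite mulKmx ?toC_unit.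
rewrite /ham_mx -mulmxA key !mulmxA mulNmx mulmxN ds_mxJ.
by rewrite !mulNmx opprK scaleNr -scalemxAl scalerN opprK.
Qed.

(** In $ds_i(JX_{s_j})$ the operator [J] acts as $-i$ on the vector and as $i$ on the covector,
    which forces the pairing to vanish. *)
Lemma ham_ds : ham_mx *m ds_mx^T = 0.
Proof.
have dJ : toC J *m ds_mx^T = 'i%C *: ds_mx^T.
  by have := congr1 trmx ds_mxJ; rewrite trmx_mul trmxK linearZ.
have : ham_mx *m toC J *m ds_mx^T = 'i%C *: (ham_mx *m ds_mx^T).
  by rewrite -mulmxA dJ -scalemxAr.
rewrite ham_mxJ -scalemxAl scaleNr => /eqP.
rewrite eq_sym -addr_eq0 -mulr2n -scaler_nat !scaler_eq0 pnatr_eq0 /=.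
by rewrite eq_complex /= oner_eq0 andbF => /eqP.
Qed.

(** The complex form of [F_dS]: $ds_j(\xi^\#)=i\langle\xi,w_j\rangle s_j$. *)
Lemma F_ds : toC F *m ds_mx^T = 'i%C *: (toC W^T *m diag_mx (\row_j s j)).
Proof.
have Fl : F *m lsubmx dS = W^T *m diag_mx (\row_j - complex.Im (s j)).
  by rewrite -(row_mxKl (F *m lsubmx dS) (F *m rsubmx dS)) -mul_mx_row hsubmxK F_dS row_mxKl.
have Fr : F *m rsubmx dS = W^T *m diag_mx (\row_j complex.Re (s j)).
  by rewrite -(row_mxKr (F *m lsubmx dS) (F *m rsubmx dS)) -mul_mx_row hsubmxK F_dS row_mxKr.
rewrite trmxK mulmxDr -scalemxAr -!toCM Fl Fr.
apply/matrixP => i j; rewrite !mul_mx_diag !mxE.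
case: (s j) => x y; apply/eqP; rewrite eq_complex /=.
by apply/andP; split; apply/eqP; ring.
Qed.

(** The derivative of $s_j$ along $v^\#$ is proportional to $\langle v,w_j\rangle s_j$. It vanishes
    by assumption for [j < r] and because $s_j=0$ for the other indices, and [dS] is invertible. *)
Lemma F_kernel (v : 'rV[R]_n) :
  (forall j : 'I_n, (j < r)%N -> (v *m W^T) 0 j = 0) -> v *m F = 0.
Proof.
move=> v0; have vD (f : C -> R) : f 0 = 0 -> v *m (W^T *m diag_mx (\row_j f (s j))) = 0.
  move=> f0; apply/rowP => j; rewrite mulmxA mul_mx_diag !mxE.
  have [jr|rj] := ltnP j r; last by rewrite s_eq0 // f0 mulr0.
  by have := v0 _ jr; rewrite mxE => ->; rewrite mul0r.
have : v *m F *m dS = 0.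
  rewrite -mulmxA F_dS mul_mx_row vD // (vD (fun z => - complex.Im z)) ?oppr0 //.
  by rewrite row_mx0.
by move/eqP; rewrite mulmx_free_eq0 ?row_free_unit // => /eqP.
Qed.

Lemma F_ds_kernel_real (v : 'rV[C]_n) (j : 'I_n) : v *m toC F *m ds_mx^T = 0 ->
  (j < r)%N -> (v *m toC W^T) 0 j = 0.
Proof.
rewrite -mulmxA F_ds -scalemxAr => /eqP; rewrite scaler_eq0 eq_complex /= oner_eq0.
rewrite andbF /= mulmxA mul_mx_diag => /eqP /rowP /(_ j) + jr.
by rewrite !mxE => /eqP; rewrite mulf_eq0 (negbTE (s_neq0 jr)) orbF => /eqP.
Qed.

(** A complexified orbit vector killed by all $ds_j$ is zero: dividing by $s_j\ne0$ shows that the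
    first [r] weights vanish on [v], hence on its real and imaginary parts, as the weights are
    real. *)
Lemma F_ds_kernel (v : 'rV[C]_n) : v *m toC F *m ds_mx^T = 0 -> v *m toC F = 0.
Proof.
move=> v0; apply: re_im_mx0; rewrite ?re_mx_mul ?im_mx_mul.
  by apply: F_kernel => j jr; rewrite -re_mx_mul mxE (F_ds_kernel_real v0 jr).
by apply: F_kernel => j jr; rewrite -im_mx_mul mxE (F_ds_kernel_real v0 jr).
Qed.

(* Pairing with [u W]: the [BK]-part drops out by [K]-invariance of the weights
   involved, leaving the Hessian at [u W BQ^T]. *)
Lemma hessian_free (a : 'rV[R]_k) (u : 'rV[R]_n) :
  (forall j : 'I_n, (j < p)%N -> u 0 j = 0) ->
  (forall j : 'I_n, (r <= j)%N -> u 0 j = 0) ->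
  (a *m BK + u *m Xi_mx) *m F = 0 -> u = 0.
Proof.
move=> up ur aF.
have uBK : u *m W *m BK^T = 0.
  apply: trmx_inj; rewrite !trmx_mul trmxK trmx0 mulmxA.
  apply/colP => i; rewrite !mxE big1 // => j _; rewrite !mxE.
  have [jp|pj] := ltnP j p; first by rewrite up // mulr0.
  have [jr|rj] := ltnP j r; last by rewrite ur // mulr0.
  have /colP/(_ i) := BK_W pj jr; rewrite !mxE => h.
  suff -> : \sum_j0 BK i j0 * W^T j0 j = 0 by rewrite mul0r.
  by rewrite -[RHS]h; apply: eq_bigr => l _; rewrite !mxE.
(* The covector [u *m W] already vanishes on the Lie algebra of $K$, so it suffices that it vanish
   on that of $Q$; otherwise the Hessian would be positive there. *)
apply: weight_free => //; apply: span_KQ => //.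
apply/eqP; apply: contraT => /H_pos.
suff -> : (u *m W *m BQ^T *m H *m (u *m W *m BQ^T)^T) = 0 by rewrite mxE ltxx.
have -> : u *m W *m BQ^T *m H *m (u *m W *m BQ^T)^T = (a *m BK + u *m Xi_mx) *m W^T *m u^T.
  rewrite mulmxDl mulmxDl -!mulmxA.
  have -> : BK *m (W^T *m u^T) = (u *m W *m BK^T)^T by rewrite !trmx_mul trmxK.
  by rewrite uBK trmx0 mulmx0 add0r /Xi_mx !trmx_mul trmxK !mulmxA.
(* Reading the zero vector in the slice coordinates gives the value of each weight times $s_j$. For
   [j < r] one of the two real parts of $s_j$ is nonzero and can be cancelled; for the other indices
   $u_j=0$. *)
have : (a *m BK + u *m Xi_mx) *m F *m dS = 0 by rewrite aF mul0mx.
rewrite -mulmxA F_dS mul_mx_row -[0]row_mx0 => /eq_row_mx [].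
rewrite !mulmxA => /rowP im0 /rowP re0.
apply/rowP => i; rewrite mxE [in RHS]mxE ord1 big1 // => j _.
have [jr|rj] := ltnP j r; last by rewrite [u^T _ _]mxE ur // mulr0.
move: (im0 j) (re0 j) (s_neq0 jr); rewrite !mul_mx_diag !mxE.
case: (s j) => x y /=; set z := \sum_ _ _ => z1 z2.
rewrite eq_complex /= negb_and => xy.
suff -> : z = 0 by rewrite mul0r.
case/orP: xy => /mulIf; apply; rewrite mul0r //.
by apply/eqP; rewrite -oppr_eq0 -mulrN; apply/eqP.
Qed.

Lemma pid_mx_coord (c : 'rV[C]_n) (j : 'I_n) :
  c *m (pid_mx p : 'M[C]_(n, p)) = 0 -> (j < p)%N -> c 0 j = 0.
Proof.
move=> c0 jp; have /rowP/(_ (Ordinal jp)) := c0.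
rewrite !mxE (bigD1 j) //= !mxE eqxx /= jp mulr1 big1 ?addr0 //.
by move=> i ij; rewrite !mxE -val_eqE /= in ij *; rewrite (negbTE ij) mulr0.
Qed.

(* A common shape for the frames at finite t and in the limit: d1 and d2 weigh
   the two parts of X_{s_j} + t s_j Xi_j^#. *)
Definition frame (d1 : 'rV[C]_n) (d2 : 'rV[R]_n) : 'M[C]_(n, N) :=
  pid_mx p *m toC (row_base (BK *m F)) + diag_mx d1 *m ham_mx
  + toC (diag_mx d2 *m Xi_mx *m F).

(* Pairing with the ds_j kills the [ham_mx] part, as the span of the ds_j is
   Lagrangian, and detects vectors tangent to the orbit. *)
Lemma frame_free (d1 : 'rV[C]_n) (d2 : 'rV[R]_n) :
  (forall j : 'I_n, (j < p)%N -> d2 0 j = 0) ->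
  (forall j : 'I_n, (r <= j)%N -> d2 0 j = 0) ->
  (forall j : 'I_n, (p <= j)%N -> (d1 0 j != 0) || (d2 0 j != 0)) ->
  row_free (frame d1 d2).
Proof.
move=> d2p d2r d12; apply/inj_row_free => c c0.
have /submxP[Y YE] : (row_base (BK *m F) <= BK *m F)%MS by rewrite eq_row_base.
(* [xi] collects everything tangent to the complexified torus orbit, so that the combination splits
   into an orbit part and a [ham_mx] part. *)
pose xi := c *m pid_mx p *m toC (Y *m BK) + c *m toC (diag_mx d2 *m Xi_mx).
have cE : c *m frame d1 d2 = xi *m toC F + c *m diag_mx d1 *m ham_mx.
  rewrite /xi /frame YE !mulmxDr mulmxDl !toCM !mulmxA.
  by rewrite -!addrA; congr (_ + _); rewrite addrC.
have xiF : xi *m toC F = 0.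
  apply: F_ds_kernel; have : c *m frame d1 d2 *m ds_mx^T = 0 by rewrite c0 mul0mx.
  by rewrite cE mulmxDl -[X in _ + X]mulmxA ham_ds mulmx0 addr0.
have cd1 : c *m diag_mx d1 = 0.
  by move/eqP: cE; rewrite c0 xiF add0r eq_sym mulmx_free_eq0 ?ham_mx_free // => /eqP.
(* [hessian_free] is a real statement, so it is applied to the real and the imaginary part of the
   relation separately. *)
have cd2 : c *m toC (diag_mx d2) = 0.
  have diag0 (u : 'rV[R]_n) (j : 'I_n) : d2 0 j = 0 -> (u *m diag_mx d2) 0 j = 0.
    by move=> d0; rewrite mul_mx_diag !mxE d0 mulr0.
  apply: re_im_mx0; rewrite ?re_mx_mul ?im_mx_mul.
    apply: (@hessian_free (re_mx (c *m pid_mx p) *m Y)) => [j jp|j rj|].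
    - by rewrite diag0 // d2p.
    - by rewrite diag0 // d2r.
    have := congr1 (@re_mx R _ _) xiF.
    by rewrite re_mx0 re_mx_mul re_mxD !re_mx_mul !mulmxA.
  apply: (@hessian_free (im_mx (c *m pid_mx p) *m Y)) => [j jp|j rj|].
    - by rewrite diag0 // d2p.
    - by rewrite diag0 // d2r.
  have := congr1 (@im_mx R _ _) xiF.
    by rewrite im_mx0 im_mx_mul im_mxD !im_mx_mul !mulmxA.
(* With both diagonal contributions gone, only a combination of the independent rows of [row_base]
   is left. *)
have cp : c *m (pid_mx p : 'M[C]_(n, p)) = 0.
  move: c0; rewrite /frame !mulmxDr [c *m (diag_mx d1 *m _)]mulmxA cd1 mul0mx addr0.
  rewrite -[diag_mx d2 *m Xi_mx *m F]mulmxA toCM [c *m (toC (diag_mx d2) *m _)]mulmxA cd2.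
  rewrite mul0mx addr0 mulmxA.
  move/eqP; rewrite mulmx_free_eq0 /=; first by move/eqP.
  by rewrite /toC row_free_map row_base_free.
apply/rowP => j; rewrite [RHS]mxE.
have [jp|pj] := ltnP j p; first exact: pid_mx_coord cp jp.
case/orP: (d12 j pj) => dj.
  have /rowP/(_ j) := cd1; rewrite mul_mx_diag !mxE => /eqP.
  by rewrite mulf_eq0 (negbTE dj) orbF => /eqP.
have : re_mx c *m diag_mx d2 = 0 /\ im_mx c *m diag_mx d2 = 0.
  by rewrite -re_mx_mul -im_mx_mul cd2 re_mx0 im_mx0.
case=> /rowP/(_ j) + /rowP/(_ j); rewrite !mul_mx_diag !mxE => /eqP.
rewrite mulf_eq0 (negbTE dj) orbF => /eqP re0 /eqP.
rewrite mulf_eq0 (negbTE dj) orbF => /eqP.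
by move: re0; case: (c 0 j) => x y /= -> ->.
Qed.

Lemma frame_base (d1 : 'rV[C]_n) (d2 : 'rV[R]_n) :
  (forall j : 'I_n, (j < p)%N -> d1 0 j = 0) ->
  (forall j : 'I_n, (j < p)%N -> d2 0 j = 0) ->
  (pid_mx p : 'M[C]_(p, n)) *m frame d1 d2 = toC (row_base (BK *m F)).
Proof.
move=> d1p d2p.
have kill (d : 'rV[C]_n) : (forall j : 'I_n, (j < p)%N -> d 0 j = 0) ->
    (pid_mx p : 'M[C]_(p, n)) *m diag_mx d = 0.
  move=> dp; apply/matrixP => i j; rewrite mul_mx_diag !mxE.
  have [/eqP ij|_] := boolP (_ == _); last by rewrite mul0r.
  by rewrite dp ?mulr0 // -ij.
rewrite /frame !mulmxDr -[diag_mx d2 *m Xi_mx *m F]mulmxA toCM.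
rewrite [_ *m (diag_mx d1 *m _)]mulmxA kill // mul0mx addr0.
rewrite [_ *m (toC (diag_mx d2) *m _)]mulmxA.
have -> : toC (diag_mx d2) = diag_mx (toC d2) by rewrite /toC map_diag_mx.
rewrite kill ?mul0mx ?addr0; last by move=> j jp; rewrite mxE d2p.
by rewrite mulmxA pid_mx_id ?(leq_trans p_le_r) // pid_mx_1 mul1mx.
Qed.

Lemma row_frame (d1 : 'rV[C]_n) (d2 : 'rV[R]_n) (j : 'I_n) : (p <= j)%N ->
  row j (frame d1 d2) = d1 0 j *: row j ham_mx + (d2 0 j)%:C%C *: toC (row j Xi_mx *m F).
Proof.
move=> pj; rewrite /frame !linearD /= [row j (_ *m toC _)]row_mul [row j (_ *m ham_mx)]row_mul.
have -> : row j (pid_mx p : 'M[C]_(n, p)) = 0.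
  apply/rowP => l; rewrite !mxE; case: eqP => //= jl.
  by rewrite ltnNge pj.
rewrite mul0mx add0r row_diag_mx -scalemxAl -rowE; congr (_ + _).
rewrite -toCZ /toC -map_row; congr map_mx.
by rewrite -mulmxA row_mul row_diag_mx -scalemxAl -rowE row_mul.
Qed.

(** The first [p] rows are a basis of the tangent space of the $K$-orbit, and the nonzero factors
    [a j] do not change the lines of the other rows. *)
Lemma frame_span (d1 : 'rV[C]_n) (d2 : 'rV[R]_n) (a : 'I_n -> C) (v : 'I_n -> 'rV[C]_N) :
  (forall j : 'I_n, (j < p)%N -> d1 0 j = 0) ->
  (forall j : 'I_n, (j < p)%N -> d2 0 j = 0) ->
  (forall j, a j != 0) ->
  (forall j : 'I_n, (p <= j)%N -> row j (frame d1 d2) = a j *: v j) ->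
  (frame d1 d2 :=: toC (BK *m F) + \sum_(j < n | (p <= j)%N) <<v j>>)%MS.
Proof.
move=> d1p d2p a0 fv; apply/eqmxP/andP; split.
  apply/row_subP => j; have [jp|pj] := ltnP j p.
    apply: submx_trans (addsmxSl _ _).
    rewrite /frame !linearD /=.
    rewrite [row j (_ *m toC _)]row_mul [row j (_ *m ham_mx)]row_mul.
    rewrite row_diag_mx d1p // scale0r mul0mx addr0.
    have -> : row j (toC (diag_mx d2 *m Xi_mx *m F)) = 0.
      rewrite -mulmxA toCM row_mul /toC map_diag_mx.
      by rewrite row_diag_mx mxE d2p // scale0r mul0mx.
    rewrite addr0; apply: submx_trans (submxMl _ _) _.
    by rewrite /toC map_submx eq_row_base.
  rewrite fv //; apply: scalemx_sub; apply: submx_trans (addsmxSr _ _).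
  by apply: (sumsmx_sup j) => //; rewrite genmxE.
rewrite addsmx_sub; apply/andP; split.
  apply: (@submx_trans _ _ _ _ _ _ (toC (row_base (BK *m F)))).
    by rewrite /toC map_submx eq_row_base.
  by rewrite -(frame_base d1p d2p) submxMl.
apply/sumsmx_subP => j pj; rewrite genmxE.
have -> : v j = (a j)^-1 *: row j (frame d1 d2) by rewrite fv // scalerK.
by apply: scalemx_sub; exact: row_sub.
Qed.

(** The $ds_j$ exhaust the covectors of type (1,0). Writing $b=\sum_j(\alpha_j\,dx_j+\beta_j\,dy_j)$
    with $s_j=x_j+iy_j$, the eigenvalue equation says $\beta=i\alpha$, whence
    $b=\sum_j\alpha_j\,ds_j$. *)
Lemma ds_mx_complete (b : 'rV[C]_N) : b *m (toC J)^T = 'i%C *: b ->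
  exists a : 'rV[C]_n, b = a *m ds_mx.
Proof.
move=> bJ; have [Jl Jr] := J_split.
have dU : (toC dS)^T \in unitmx by rewrite unitmx_tr /toC map_unitmx.
pose ab := b *m invmx (toC dS)^T.
have bE : b = lsubmx ab *m (toC (lsubmx dS))^T + rsubmx ab *m (toC (rsubmx dS))^T.
  by rewrite -mul_row_col hsubmxK -tr_row_mx /toC -map_row_mx hsubmxK mulmxKV.
have : row_mx (rsubmx ab - 'i%C *: lsubmx ab) (- lsubmx ab - 'i%C *: rsubmx ab) = 0.
  apply/eqP; rewrite -(mulmx_free_eq0 _ (B := (toC dS)^T)) ?row_free_unit //.
  rewrite -[X in (toC X)^T]hsubmxK /toC map_row_mx -!/(toC _) tr_row_mx mul_row_col.
  rewrite !mulmxBl -!scalemxAl mulNmx addrACA -opprD -scalerDr -bE -bJ bE.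
  rewrite mulmxDl -!mulmxA -!trmx_mul -!toCM Jl Jr.
  have -> : toC (- rsubmx dS) = - toC (rsubmx dS) by rewrite /toC map_mxN.
  by rewrite linearN /= mulmxN; apply/eqP; rewrite [X in _ - X]addrC subrr.
move/(congr1 lsubmx); rewrite row_mxKl linear0 => /eqP; rewrite subr_eq0 => /eqP abE.
exists (lsubmx ab); rewrite bE abE /ds_mx linearD linearZ /= mulmxDr.
by rewrite -scalemxAl -scalemxAr.
Qed.

(** In the limit the $z_k$ ([r <= j]) keep $X_{z_k}$, while the $K$-invariant $w_j$ ([p <= j < r])
    keep only the orbit direction $\Xi_j^\#$. *)
Definition limit_d1 : 'rV[C]_n := \row_j (r <= j)%N%:R.
Definition limit_d2 : 'rV[R]_n := \row_j (p <= j < r)%N%:R.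

Lemma frame_limit_free : row_free (frame limit_d1 limit_d2).
Proof.
apply: frame_free => j; rewrite !mxE.
- by move=> jp; rewrite leqNgt jp.
- by move=> rj; rewrite ltnNge rj andbF.
- by move=> pj; rewrite pj /= ltnNge; case: (r <= j)%N; rewrite !oner_eq0 ?orbT.
Qed.

(** Each limit row lies in one of the two summands of $\mathcal P_{\mathbb R}$. Conversely, a vector
    of $\mathcal P_J$ is a combination of the $X_{s_j}$, and being in the kernel of $d\mu$ leaves
    only the $X_{z_k}$; the orbit directions are recovered by counting dimensions. *)
Lemma frame_limit (D : 'M[R]_(N, n)) : Om^T = - Om -> F *m Om = - D^T ->
  (frame limit_d1 limit_d2 :=:
    (kermx (toC D) :&: eigenspace (toC J) (- 'i)%C) + toC F)%MS.
Proof.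
move=> Om_alt F_Om.
have d1p (j : 'I_n) : (j < p)%N -> limit_d1 0 j = 0.
  by move=> jp; rewrite mxE leqNgt (leq_trans jp p_le_r).
have d1r (j : 'I_n) : (j < r)%N -> limit_d1 0 j = 0.
  by move=> jr; rewrite mxE leqNgt jr.
have d2p (j : 'I_n) : (j < p)%N -> limit_d2 0 j = 0.
  by move=> jp; rewrite mxE leqNgt jp.
have d2r (j : 'I_n) : (r <= j)%N -> limit_d2 0 j = 0.
  by move=> rj; rewrite mxE ltnNge rj andbF.
have ffree := frame_limit_free.
(* By the moment map equation, $d\mu(X_{s_j})$ is dual to the values $ds_j(\xi^\#)$, so it equals
   $-i s_j w_j$. *)
have ham_D : ham_mx *m toC D = - ('i%C *: (diag_mx (\row_j s j) *m toC W)).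
  have -> : D = Om *m F^T.
    by rewrite -[D]trmxK -[Om]trmxK -trmx_mul Om_alt mulmxN F_Om opprK.
  rewrite toCM mulmxA /ham_mx mulmxKV ?toC_unit // mulNmx toC_tr.
  rewrite -[X in - X]trmxK trmx_mul trmxK F_ds linearZ /= trmx_mul tr_diag_mx.
  by rewrite -toC_tr trmxK.
apply/eqmxP/andP; split.
  apply/row_subP => j; have [jp|pj] := ltnP j p.
    rewrite /frame !linearD /= [row j (_ *m toC _)]row_mul [row j (_ *m ham_mx)]row_mul.
    rewrite row_diag_mx d1p // scale0r mul0mx addr0.
    apply: submx_trans (addsmxSr _ _); apply: addmx_sub.
      apply: submx_trans (submxMl _ _) _.
      by rewrite /toC map_submx eq_row_base submxMl.
    by apply: submx_trans (row_sub _ _) _; rewrite toCM submxMl.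
  rewrite row_frame //; apply: addmx_sub; last first.
    apply: scalemx_sub; apply: submx_trans (addsmxSr _ _).
    by rewrite toCM submxMl.
  have [jr|rj] := ltnP j r; first by rewrite d1r // scale0r sub0mx.
  apply: scalemx_sub; apply: submx_trans (addsmxSl _ _).
  rewrite sub_capmx; apply/andP; split.
    apply/sub_kermxP; rewrite -row_mul ham_D.
    rewrite linearN linearZ /= [row j (_ *m toC W)]row_mul row_diag_mx.
    by rewrite mxE s_eq0 // scale0r mul0mx scaler0 oppr0.
  by apply/eigenspaceP; rewrite -row_mul ham_mxJ linearZ.
rewrite addsmx_sub; apply/andP; split.
  apply/rV_subP => v; rewrite sub_capmx => /andP[/sub_kermxP vD /eigenspaceP vJ].
  (* Contracting the form with a vector of $\mathcal P_J$ gives a covector of type (1,0), to which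
     [ds_mx_complete] applies. *)
  have : v *m toC Om *m (toC J)^T = 'i%C *: (v *m toC Om).
    rewrite -mulmxA; have -> : toC Om *m (toC J)^T = - (toC J *m toC Om) by rewrite toC_J_Om opprK.
    by rewrite mulmxN mulmxA vJ -scalemxAl scaleNr opprK.
  case/ds_mx_complete => a aE.
  have vE : v = - a *m ham_mx.
    by rewrite /ham_mx mulmxA mulNmx mulmxN opprK -aE mulmxK ?toC_unit.
  have : a *m diag_mx (\row_j s j) *m toC W = 0.
    have : - a *m (ham_mx *m toC D) = 0 by rewrite mulmxA -vE.
    rewrite ham_D mulmxN mulNmx opprK -scalemxAr => /eqP.
    by rewrite scaler_eq0 eq_complex /= oner_eq0 andbF /= mulmxA => /eqP.
  set as_ := a *m _ => asW.
  have as_r (j : 'I_n) : (r <= j)%N -> as_ 0 j = 0.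
    by move=> rj; rewrite /as_ mul_mx_diag !mxE s_eq0 // mulr0.
  (* The relation $\sum_j a_js_jw_j=0$ involves only the independent weights, so $a_j=0$ wherever
     $s_j\ne0$. *)
  have as0 : as_ = 0.
    apply: re_im_mx0; apply: weight_free.
    - by move=> j rj; rewrite mxE as_r.
    - by rewrite -re_mx_mul asW re_mx0.
    - by move=> j rj; rewrite mxE as_r.
    - by rewrite -im_mx_mul asW im_mx0.
  have a0 (j : 'I_n) : (j < r)%N -> a 0 j = 0.
    move=> jr; have /rowP/(_ j) := as0; rewrite /as_ mul_mx_diag !mxE => /eqP.
    by rewrite mulf_eq0 (negbTE (s_neq0 jr)) orbF => /eqP.
  have -> : v = - a *m frame limit_d1 limit_d2.
    rewrite vE !mulNmx; congr (- _).
    rewrite (mulmx_sum_row a ham_mx) (mulmx_sum_row a (frame _ _)).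
    apply: eq_bigr => j _; have [jr|rj] := ltnP j r; first by rewrite a0 // !scale0r.
    rewrite row_frame ?(leq_trans p_le_r) // d2r // scale0r addr0.
    by rewrite mxE rj scale1r.
  by rewrite submxMl.
(* The rows of index below [r] are [r] independent vectors of the complexified orbit space, whose
   dimension is also [r], so they span it. *)
have rankr : \rank ((pid_mx r : 'M[C]_n) *m frame limit_d1 limit_d2) = r.
  by rewrite mxrankMfree // rank_pid_mx ?r_le_n.
suff /mxrank_leqif_eq : ((pid_mx r : 'M[C]_n) *m frame limit_d1 limit_d2 <= toC F)%MS.
  rewrite rankr /toC mxrank_map => -[_]; rewrite eqxx => /esym /andP[_ h].
  by apply: submx_trans h _; rewrite submxMl.
rewrite /frame !mulmxDr; apply: addmx_sub; last by rewrite toCM mulmxA submxMl.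
apply: addmx_sub.
  rewrite mulmxA; apply: submx_trans (submxMl _ _) _.
  by rewrite /toC map_submx eq_row_base submxMl.
rewrite mulmxA; have -> : (pid_mx r : 'M[C]_n) *m diag_mx limit_d1 = 0.
  apply/matrixP => i j; rewrite mul_mx_diag !mxE.
  have [/andP[/eqP ij ir]|_] := boolP (_ && _); last by rewrite mul0r.
  by rewrite -ij leqNgt ir mulr0.
by rewrite mul0mx sub0mx.
Qed.

(** After rescaling, the frame depends affinely on $u=1/(1+t)$, so its convergence is that of $u$ to
    zero. [frame_free] gives independence both at finite time and in the limit. *)
Lemma frame_cvg (D : 'M[R]_(N, n)) (V : R -> 'M[C]_N)
    (a : R -> 'I_n -> C) (v : R -> 'I_n -> 'rV[C]_N) :
  Om^T = - Om -> F *m Om = - D^T ->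
  (forall t j, a t j != 0) ->
  (forall t (j : 'I_n), (p <= j)%N ->
    v t j = a t j *: (row j ham_mx + (t%:C%C * s j) *: toC (row j Xi_mx *m F))) ->
  (forall t, V t = toC (BK *m F) + \sum_(j < n | (p <= j)%N) <<v t j>>)%MS ->
  grass_cvg n V ((kermx (toC D) :&: eigenspace (toC J) (- 'i)%C) + toC F)%MS.
Proof.
move=> Om_alt F_Om a0 vE VE.
(* The vector of index p <= j < r is divided by (1 + t) s_j. *)
pose B0 := frame limit_d1 limit_d2.
pose g : 'rV[C]_n := \row_j (if (p <= j < r)%N then (s j)^-1 else 0).
pose G := diag_mx g *m ham_mx - toC (diag_mx limit_d2 *m Xi_mx *m F).
(* Dividing by $1+t$ rather than $t$ keeps the frame valid at $t=0$; the coefficient of $\Xi_j^\#$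
   becomes $t/(1+t)=1-u$. *)
pose u (t : R) : R := (1 + t)^-1.
pose d1 t := limit_d1 + (u t)%:C%C *: g.
pose d2 t := (1 - u t) *: limit_d2.
pose B t := frame (d1 t) (d2 t).
have BE t : B t = B0 + (u t)%:C%C *: G.
  rewrite /B /B0 /G /frame /d1 /d2 linearD !linearZ /= mulmxDl -!scalemxAl toCZ.
  rewrite rmorphB rmorph1 scalerBl scale1r scalerBr !addrA.
  by congr (_ - _); rewrite addrAC.
have u_neq0 t : 0 <= t -> (u t)%:C%C != 0.
  by move=> t0; rewrite eq_complex /= eqxx andbT invr_neq0 // gt_eqF // ltr_pwDl.
have Bspan t : 0 <= t -> (B t :=: V t)%MS.
  move=> t0; rewrite VE.
  apply: (@frame_span _ _ (fun j => (a t j)^-1 * (if (j < r)%N then (u t)%:C%C * (s j)^-1 else 1))).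
  - move=> j jp; rewrite !mxE leqNgt (leq_trans jp p_le_r) [(p <= j)%N]leqNgt jp /=.
    by rewrite mulr0 addr0.
  - by move=> j jp; rewrite !mxE leqNgt jp mulr0.
  - move=> j; rewrite mulf_neq0 ?invr_neq0 ?a0 //; case: ifP => jr; rewrite ?oner_eq0 //.
    by rewrite mulf_neq0 ?u_neq0 // invr_neq0 // s_neq0.
  - move=> j pj; rewrite row_frame // vE // scalerA mulrAC mulVf ?a0 // mul1r !mxE pj /=.
    have [jr|rj] := ltnP j r.
      rewrite add0r mulr1 scalerDr scalerA; congr (_ + _ *: _).
      rewrite mulrACA mulVf ?s_neq0 // mulr1 -rmorphM /=.
      congr (_%:C)%C; rewrite /u; field.
      by rewrite gt_eqF // ltr_pwDl.
    by rewrite mulr0 addr0 mulr0 scale0r addr0 s_eq0 // mulr0 scale0r addr0.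
have B0free := frame_limit_free.
have Bfree t : 0 <= t -> row_free (B t).
  move=> t0; apply: frame_free => j; rewrite !mxE.
  - by move=> jp; rewrite leqNgt jp mulr0.
  - by move=> rj; rewrite ltnNge rj andbF mulr0.
  - move=> pj; rewrite pj /=; have [jr|rj] := ltnP j r.
      by rewrite add0r mulf_neq0 ?u_neq0 // invr_neq0 // s_neq0.
    by rewrite mulr0 addr0 oner_eq0.
have B0span := frame_limit Om_alt F_Om.
split.
- by move=> t t0; rewrite -(Bspan t t0); apply/eqP; exact: Bfree.
- by rewrite -B0span; apply/eqP.
have u0 : u t @[t --> +oo] --> (0 : R).
  apply/gtr0_cvgV0.
    by apply: filterS (nbhs_pinfty_ge (num_real 0)) => t t0; exact: ltr_pwDl.
  apply/cvgryPge => x.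
  by apply: filterS (nbhs_pinfty_ge (num_real x)) => t xt; exact: ler_wpDl.
have cvg_aux (x y : R) : x + u t * y @[t --> +oo] --> x.
  rewrite -[X in _ --> X]addr0 -[in X in _ --> X](mul0r y).
  by apply: cvgD; [exact: cvg_cst | apply: cvgM => //; exact: cvg_cst].
exists B, B0; split => //.
- move=> i j.
  rewrite (_ : (fun t => _) = fun t => complex.Re (B0 i j) + u t * complex.Re (G i j)) //.
  apply/funext => t; rewrite BE mxE [X in _ + X]mxE.
  by case: (B0 i j) => ? ?; case: (G i j) => ? ? /=; rewrite mul0r subr0.
- move=> i j.
  rewrite (_ : (fun t => _) = fun t => complex.Im (B0 i j) + u t * complex.Im (G i j)) //.
  apply/funext => t; rewrite BE mxE [X in _ + X]mxE.
  by case: (B0 i j) => ? ?; case: (G i j) => ? ? /=; rewrite mul0r addr0.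
Qed.

End Frames.

(** * Calculus *)

Section Calculus.
Context {R : realType}.

Lemma derive_comp (U V W : normedModType R) (f : U -> V) (g : V -> W) (a v : U) :
  differentiable f a -> differentiable g (f a) ->
  'D_v (g \o f) a = 'D_('D_v f a) g (f a).
Proof.
move=> df dg; rewrite deriveE; last exact: differentiable_comp.
by rewrite diff_comp //= -deriveE // -deriveE.
Qed.

Lemma derive_comp_real (V : normedModType R) (f : V -> R) (g : R -> R) (a v : V) :
  differentiable f a -> derivable g (f a) 1 ->
  'D_v (g \o f) a = 'D_1 g (f a) * 'D_v f a.
Proof.
move=> df /derivable1_diffP dg; rewrite derive_comp // deriveE // diff1E //.
by rewrite derive1E mulrC.
Qed.

Lemma derive_rV (W : normedModType R) m (f : 'rV[R]_m -> W) (a v : 'rV[R]_m) :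
  differentiable f a -> 'D_v f a = \sum_i v 0 i *: 'D_(basis_vec R i) f a.
Proof.
move=> df; rewrite deriveE // {1}(row_sum_delta v) linear_sum.
by apply: eq_bigr => i _; rewrite linearZ deriveE.
Qed.

Lemma differentiable_mulmxr a b (B : 'M[R]_(a, b)) (u : 'rV[R]_a) :
  differentiable (mulmxr B : 'rV[R]_a -> 'rV[R]_b) u.
Proof.
have -> : (mulmxr B : 'rV[R]_a -> 'rV[R]_b) = \sum_(i < a) (fun v : 'rV[R]_a => v 0 i *: row i B).
  by apply/funext => v; rewrite /= mulmx_sum_row fct_sumE.
by apply: differentiable_sum => i; apply: differentiableZl; exact: differentiable_coord.
Qed.

Lemma derive_mulmxr a b (B : 'M[R]_(a, b)) (u v : 'rV[R]_a) :
  'D_v (mulmxr B : 'rV[R]_a -> 'rV[R]_b) u = v *m B.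
Proof.
rewrite deriveE; last exact: differentiable_mulmxr.
rewrite diff_lin // => w; exact/differentiable_continuous/differentiable_mulmxr.
Qed.

Lemma derive_coord (V : normedModType R) a b (f : V -> 'M[R]_(a, b)) (x v : V) i j :
  differentiable f x -> 'D_v (fun y => f y i j) x = ('D_v f x) i j.
Proof.
by move=> df; rewrite derive_mx ?mxE //; exact: diff_derivable.
Qed.

Lemma differentiable_entry (V : normedModType R) a b (f : V -> 'M[R]_(a, b)) (x : V) i j :
  differentiable f x -> differentiable (fun y => f y i j) x.
Proof.
move=> df; apply: (@differentiable_comp _ _ _ _ f (fun N : 'M[R]_(a, b) => N i j : R)) => //.
exact: differentiable_coord.
Qed.

Definition grad m (f : 'rV[R]_m -> R) (u : 'rV[R]_m) : 'rV[R]_m :=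
  \row_i 'D_(basis_vec R i) f u.

Lemma gradP m (f : 'rV[R]_m -> R) (u v : 'rV[R]_m) :
  differentiable f u -> 'D_v f u = pairing v (grad f u).
Proof.
by move=> df; rewrite derive_rV // /pairing mxE; apply: eq_bigr => i _; rewrite !mxE.
Qed.

Lemma pairingE m (u v : 'rV[R]_m) : pairing u v = \sum_i u 0 i * v 0 i.
Proof. by rewrite /pairing mxE; apply: eq_bigr => i _; rewrite mxE. Qed.

Lemma pairingC m (u v : 'rV[R]_m) : pairing u v = pairing v u.
Proof. by rewrite !pairingE; apply: eq_bigr => i _; rewrite mulrC. Qed.

Lemma pairing_mulmx a b (u : 'rV[R]_a) (B : 'M[R]_(a, b)) (v : 'rV[R]_b) :
  pairing (u *m B) v = pairing u (v *m B^T).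
Proof. by rewrite /pairing trmx_mul trmxK mulmxA. Qed.

Lemma pairing_rV_inj m (u v : 'rV[R]_m) : (forall w, pairing w u = pairing w v) -> u = v.
Proof.
move=> uv; apply/rowP => i; have := uv (delta_mx 0 i); rewrite /pairing -!rowE.
by rewrite !mxE.
Qed.

End Calculus.

(** * Derivatives along torus orbits *)

Section Manifold.
Context {R : realType} {M : topologicalType} {m : nat} (A : smooth_atlas R M m).
Local Notation C := R[i].

(** The chart is the preferred one at [y], the same in which tangent vectors at [y] are written. *)
Definition diff_at (W : normedModType R) (f : M -> W) (y : M) : Prop :=
  differentiable (f \o cinv (chart_at A y)) (chart_at A y y).

Definition cdiff_at (f : M -> C) (y : M) : Prop :=
  diff_at (fun z => complex.Re (f z)) y /\ diff_at (fun z => complex.Im (f z)) y.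

Lemma chart_atK y : cinv (chart_at A y) (chart_at A y y) = y.
Proof. by rewrite cmapK //; exact: mem_chart_at. Qed.

Lemma near_cinv (y : M) (U : set M) : nbhs y U ->
  \forall u \near chart_at A y y, U (cinv (chart_at A y) u).
Proof.
move=> yU; apply: (@cinv_continuous _ _ _ (chart_at A y)).
  by exists y => //; exact: mem_chart_at.
by rewrite chart_atK.
Qed.

(** A differential depends only on the germ. This permits differentiating formulas that hold only on
    the open domain of the slice. *)
Lemma near_eq_dfunC (f g : M -> C) (y : M) :
  (\near y, f y = g y) -> dfunC A f y = dfunC A g y.
Proof.
move=> fg; apply/rowP => i; rewrite !mxE; congr (_ +i* _)%C; apply: near_eq_derive.
  by apply: filterS (near_cinv fg) => u /= ->.
by apply: filterS (near_cinv fg) => u /= ->.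
Qed.

Lemma dfunP (f : M -> R) (y : M) (v : 'rV[R]_m) : diff_at f y ->
  'D_v (f \o cinv (chart_at A y)) (chart_at A y y) = pairing v (dfun A f y).
Proof. exact: gradP. Qed.

Lemma smooth_map_diff_at (W : normedModType R) (f : M -> W) (y : M) :
  smooth_map A f -> diff_at f y.
Proof.
move=> fs; apply: (fs _ (chart_at_atlas A y) [::]).
by exists y => //; exact: mem_chart_at.
Qed.

Lemma diff_at_cst (W : normedModType R) (a : W) (y : M) : diff_at (fun=> a) y.
Proof. exact: differentiable_cst. Qed.

Lemma diff_atM (f g : M -> R) (y : M) :
  diff_at f y -> diff_at g y -> diff_at (fun z => f z * g z) y.
Proof. exact: differentiableM. Qed.

Lemma diff_atD (f g : M -> R) (y : M) :
  diff_at f y -> diff_at g y -> diff_at (fun z => f z + g z) y.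
Proof. exact: differentiableD. Qed.

Lemma diff_atB (f g : M -> R) (y : M) :
  diff_at f y -> diff_at g y -> diff_at (fun z => f z - g z) y.
Proof. exact: differentiableB. Qed.

Lemma cdiff_atM (f g : M -> C) (y : M) :
  cdiff_at f y -> cdiff_at g y -> cdiff_at (fun z => f z * g z) y.
Proof.
move=> [f1 f2] [g1 g2]; split.
  have -> : (fun z => complex.Re (f z * g z)) =
     (fun z => complex.Re (f z) * complex.Re (g z) - complex.Im (f z) * complex.Im (g z)).
    by apply/funext => z; case: (f z); case: (g z).
  by apply: diff_atB; exact: diff_atM.
have -> : (fun z => complex.Im (f z * g z)) =
   (fun z => complex.Re (f z) * complex.Im (g z) + complex.Im (f z) * complex.Re (g z)).
  by apply/funext => z; case: (f z); case: (g z).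
by apply: diff_atD; exact: diff_atM.
Qed.

Lemma diff_at_comp (V W : normedModType R) (f : M -> V) (g : V -> W) (y : M) :
  diff_at f y -> differentiable g (f y) -> diff_at (g \o f) y.
Proof. by move=> df dg; apply: differentiable_comp => //=; rewrite chart_atK. Qed.

Lemma dfunM (f g : M -> R) (y : M) : diff_at f y -> diff_at g y ->
  dfun A (fun z => f z * g z) y = f y *: dfun A g y + g y *: dfun A f y.
Proof.
move=> df dg; apply/rowP => i; rewrite !mxE.
have := deriveM (diff_derivable (v := basis_vec R i) df) (diff_derivable (v := basis_vec R i) dg).
by rewrite /= chart_atK; exact.
Qed.

Lemma dfun_comp_real (h : M -> R) (g : R -> R) (y : M) :
  diff_at h y -> derivable g (h y) 1 ->
  dfun A (g \o h) y = 'D_1 g (h y) *: dfun A h y.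
Proof.
move=> dh dg; apply/rowP => i; rewrite !mxE.
have := @derive_comp_real _ _ _ g _ (basis_vec R i) dh.
by rewrite /= chart_atK; exact.
Qed.

Lemma dfun_comp (b : nat) (g : M -> 'rV[R]_b) (F : 'rV[R]_b -> R) (y : M) :
  diff_at g y -> differentiable F (g y) ->
  dfun A (F \o g) y = grad F (g y) *m (dvec A g y)^T.
Proof.
move=> dg dF; apply: pairing_rV_inj => v.
rewrite -pairing_mulmx -dfunP; last exact: diff_at_comp.
rewrite -gradP //.
have := @derive_comp _ _ _ _ (g \o cinv (chart_at A y)) F (chart_at A y y) v dg.
by rewrite /= chart_atK deriveEjacobian; [exact | exact: dg].
Qed.

Lemma diff_at_mulmxr (a b : nat) (g : M -> 'rV[R]_a) (B : 'M[R]_(a, b)) (y : M) :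
  diff_at g y -> diff_at (fun z => g z *m B) y.
Proof.
by move=> dg; apply: (@diff_at_comp _ _ g (mulmxr B)) => //; exact: differentiable_mulmxr.
Qed.

Lemma dvec_mulmxr (a b : nat) (g : M -> 'rV[R]_a) (B : 'M[R]_(a, b)) (y : M) :
  diff_at g y -> dvec A (fun z => g z *m B) y = dvec A g y *m B.
Proof.
move=> dg; apply/row_matrixP => i; rewrite !rowE mulmxA.
rewrite -deriveEjacobian; last exact: diff_at_mulmxr.
rewrite -deriveEjacobian // -(derive_mulmxr B (g y)).
rewrite -[X in _ = derive _ (g X) _](chart_atK y).
apply: (derive_comp (g := mulmxr B)) => //; exact: differentiable_mulmxr.
Qed.

Lemma dfun_entry (b : nat) (g : M -> 'rV[R]_b) (j : 'I_b) (y : M) :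
  diff_at g y -> dfun A (fun z => g z 0 j) y = (col j (dvec A g y))^T.
Proof.
move=> dg; apply/rowP => i; rewrite !mxE.
rewrite (derive_coord (f := g \o cinv (chart_at A y))) //.
by rewrite deriveEjacobian // /basis_vec -rowE [in LHS]mxE mxE.
Qed.

Section Orbits.
Context {n : nat} (rho : 'rV[R]_n -> M -> M) (rho_action : torus_action A rho).

(** The action is jointly smooth in charts; composing with $a\mapsto(a,y)$ leaves the orbit map. *)
Lemma orbit_differentiable (y : M) :
  differentiable (fun a => chart_at A y (rho a y)) 0.
Proof.
have cA := chart_at_atlas A y.
have := @act_smooth _ _ _ _ _ _ rho_action _ _ cA cA [::] (0, chart_at A y y).
rewrite /= chart_atK (act0 rho_action) => h.
have {}h := h (conj (ex_intro2 _ _ y (mem_chart_at A y) erefl) (mem_chart_at A y)).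
have pd : differentiable (fun a : 'rV[R]_n => (a, chart_at A y y)) 0.
  by apply: differentiable_pair; [apply: ex_diff | exact: differentiable_cst].
have := differentiable_comp pd h; rewrite /comp /=.
by under [X in differentiable X _]eq_fun do rewrite chart_atK.
Qed.

Lemma near_orbit (y : M) (U : set M) : nbhs y U -> \forall a \near (0 : 'rV[R]_n), U (rho a y).
Proof.
move=> yU; have := @act_continuous _ _ _ _ _ _ rho_action (0, y) U.
rewrite /= (act0 rho_action) => /(_ yU) [[P Q] /= [P0 Qy] PQ].
by apply: filterS P0 => a Pa; apply: (PQ (a, y)); split => //; exact: nbhs_singleton.
Qed.

(** For small [a] the orbit stays in the preferred chart at [y], so the chain rule can pass through
    that chart. Derivatives along $\xi^\#$ thereby become derivatives in the torus variable. *)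
Lemma derive_orbit (W : normedModType R) (f : M -> W) (y : M) (xi : 'rV[R]_n) :
  diff_at f y ->
  'D_xi (fun a => f (rho a y)) 0 =
  'D_(xi *m fund A rho y) (f \o cinv (chart_at A y)) (chart_at A y y).
Proof.
move=> df; rewrite -deriveEjacobian; last exact: orbit_differentiable.
have := @derive_comp _ _ _ _ (fun a => chart_at A y (rho a y))
  (f \o cinv (chart_at A y)) 0 xi (orbit_differentiable y).
rewrite (act0 rho_action) => <- //.
have cy : nbhs y (cdom (chart_at A y)).
  by apply: open_nbhs_nbhs; split; [exact: cdom_open | exact: mem_chart_at].
by apply: near_eq_derive; apply: filterS (near_orbit cy) => a ya; rewrite /= cmapK.
Qed.

Lemma dfun_orbit (f : M -> R) (y : M) (xi : 'rV[R]_n) : diff_at f y ->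
  pairing (xi *m fund A rho y) (dfun A f y) = 'D_xi (fun a => f (rho a y)) 0.
Proof. by move=> df; rewrite derive_orbit // dfunP. Qed.

(** Equivariance is required on the orbit of [y] alone, because slice coordinates are equivariant
    only on their domain. *)
Definition weight_fun (w : 'rV[R]_n) (f : M -> C) (y : M) : Prop :=
  forall a, f (rho a y) = (cos (pairing a w) +i* sin (pairing a w))%C * f y.

Lemma pairing_differentiable (w a : 'rV[R]_n) : differentiable (fun b => pairing b w) a.
Proof.
apply: (@differentiable_entry _ _ _ _ (mulmxr w^T)).
exact: differentiable_mulmxr.
Qed.

Lemma derive_pairing (w a xi : 'rV[R]_n) : 'D_xi (fun b => pairing b w) a = pairing xi w.
Proof.
rewrite (derive_coord (f := mulmxr w^T)) ?derive_mulmxr //.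
exact: differentiable_mulmxr.
Qed.

(** Differentiating $e^{i\langle a,w\rangle}f(y)$ at $a=0$ gives $i\langle\xi,w\rangle f(y)$, here
    split into real and imaginary parts. *)
Lemma weight_dfun (f : M -> C) (w xi : 'rV[R]_n) (y : M) :
  cdiff_at f y -> weight_fun w f y ->
  pairing (xi *m fund A rho y) (dfun A (fun z => complex.Re (f z)) y)
    = - (pairing xi w * complex.Im (f y)) /\
  pairing (xi *m fund A rho y) (dfun A (fun z => complex.Im (f z)) y)
    = pairing xi w * complex.Re (f y).
Proof.
move=> [f1 f2] fw; rewrite !dfun_orbit //.
have p0 : pairing 0 w = 0 by rewrite /pairing mul0mx mxE.
have dcos : 'D_xi (fun a => cos (pairing a w)) 0 = 0.
  rewrite (derive_comp_real (f := fun a => pairing a w)) ?derive_pairing; last 2 first.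
  - exact: pairing_differentiable.
  - exact: derivable_cos.
  by rewrite p0; have [_ ->] := is_derive_cos (0 : R); rewrite sin0 oppr0 mul0r.
have dsin : 'D_xi (fun a => sin (pairing a w)) 0 = pairing xi w.
  rewrite (derive_comp_real (f := fun a => pairing a w)) ?derive_pairing; last 2 first.
  - exact: pairing_differentiable.
  - exact: derivable_sin.
  by rewrite p0; have [_ ->] := is_derive_sin (0 : R); rewrite cos0 mul1r.
have ccos : derivable (fun a => cos (pairing a w)) 0 xi.
  apply: diff_derivable; apply: (@differentiable_comp _ _ _ _ (fun a => pairing a w) cos).
    exact: pairing_differentiable.
  by apply/derivable1_diffP; exact: derivable_cos.
have csin : derivable (fun a => sin (pairing a w)) 0 xi.
  apply: diff_derivable; apply: (@differentiable_comp _ _ _ _ (fun a => pairing a w) sin).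
    exact: pairing_differentiable.
  by apply/derivable1_diffP; exact: derivable_sin.
have lin (x z : R) :
    'D_xi (fun a => x * cos (pairing a w) + z * sin (pairing a w)) 0 = z * pairing xi w.
  have := deriveD (derivableZ (k := x) ccos) (derivableZ (k := z) csin).
  by rewrite (deriveZ x ccos) (deriveZ z csin) dcos dsin scaler0 add0r.
split.
  have -> : (fun a => complex.Re (f (rho a y))) = fun a =>
      complex.Re (f y) * cos (pairing a w) + - complex.Im (f y) * sin (pairing a w).
    by apply/funext => a; rewrite fw; case: (f y) => x z /=; ring.
  by rewrite lin mulNr mulrC.
have -> : (fun a => complex.Im (f (rho a y))) = fun a =>
    complex.Im (f y) * cos (pairing a w) + complex.Re (f y) * sin (pairing a w).
  by apply/funext => a; rewrite fw; case: (f y) => x z /=; ring.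
by rewrite lin mulrC.
Qed.

(** The field is compared with a fundamental field at [y] only, so [xi] may vary with the point, as
    it does for $X_\varphi$. *)
Lemma lieC_weight (V : M -> 'rV[R]_m) (f : M -> C) (w xi : 'rV[R]_n) (y : M) :
  V y = xi *m fund A rho y -> cdiff_at f y -> weight_fun w f y ->
  lieC A V f y = (0 +i* pairing xi w)%C * f y.
Proof.
move=> Vy df fw; have [hr hi] := weight_dfun xi df fw.
have : lieC A V f y = (pairing (V y) (dfun A (fun z => complex.Re (f z)) y)
    +i* pairing (V y) (dfun A (fun z => complex.Im (f z)) y))%C.
  rewrite /lieC !mxE !pairingE.
  have cs (I : Type) (s : seq I) (g h : I -> R) :
      ((\sum_(i <- s) g i) +i* (\sum_(i <- s) h i))%C = \sum_(i <- s) (g i +i* h i)%C.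
    elim: s => [|i s ih]; first by rewrite !big_nil.
    rewrite !big_cons -ih. done.
  rewrite cs; apply: eq_bigr => i _; rewrite !mxE; apply/eqP; rewrite eq_complex /=.
  by apply/andP; split; apply/eqP; ring.
rewrite Vy hr hi => ->; case: (f y) => a b /=; apply/eqP; rewrite eq_complex /=.
by apply/andP; split; apply/eqP; ring.
Qed.

End Orbits.
End Manifold.

(** * The imaginary-time flow of the slice coordinates *)

Section Hessian.
Context {R : realType} {q : nat} (phi : 'rV[R]_q -> R).
Context (phi_smooth : smooth_on setT phi).

(** The row index belongs to the inner derivative, so that [c *m hessian u] is directly the gradient
    of $\langle\nabla\phi,c\rangle$. *)
Definition hessian (u : 'rV[R]_q) : 'M[R]_q :=
  \matrix_(b, a) 'D_(basis_vec R a) (fun u' => 'D_(basis_vec R b) phi u') u.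

Lemma smooth_differentiable u : differentiable phi u.
Proof. exact: (phi_smooth [::]). Qed.

Lemma pairing_gradE (c : 'rV[R]_q) : (fun u => pairing (grad phi u) c) =
  \sum_(b < q) (c 0 b *: (fun u' => 'D_(basis_vec R b) phi u')).
Proof.
apply/funext => u; rewrite pairingE fct_sumE; apply: eq_bigr => b _.
by rewrite mxE mulrC.
Qed.

Lemma pairing_grad_differentiable (c u : 'rV[R]_q) :
  differentiable (fun u' => pairing (grad phi u') c) u.
Proof.
rewrite pairing_gradE; apply: differentiable_sum => b; apply: differentiableZ.
exact: (phi_smooth [:: basis_vec R b]).
Qed.

Lemma grad_pairing_grad (c u : 'rV[R]_q) :
  grad (fun u' => pairing (grad phi u') c) u = c *m hessian u.
Proof.
have dphi b := phi_smooth [:: basis_vec R b] (x := u) I.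
apply/rowP => a; rewrite pairing_gradE !mxE derive_sum => [|b].
  by apply: eq_bigr => b _; rewrite deriveZ ?mxE //; apply: diff_derivable; exact: dphi.
by apply: derivableZ; apply: diff_derivable; exact: dphi.
Qed.

Lemma hessianE (u v : 'rV[R]_q) :
  (v *m hessian u *m v^T) 0 0 = 'D_v (fun u' => 'D_v phi u') u.
Proof.
have -> : (fun u' => 'D_v phi u') = fun u' => pairing (grad phi u') v.
  by apply/funext => u'; rewrite gradP; [exact: pairingC | exact: smooth_differentiable].
rewrite gradP; last exact: pairing_grad_differentiable.
by rewrite grad_pairing_grad pairingC.
Qed.

End Hessian.

(** * Hamiltonian fields of functions of $\mu_Q$ and the flow of the slice coordinates *)

Section Toric.
Context {R : realType} {n k q : nat} {P : set 'rV[R]_n} (X : toric_variety P).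
Context (BK : 'M[int]_(k, n)) (BQ : 'M[int]_(q, n)) (phi : 'rV[R]_q -> R).
Context (phi_smooth : smooth_on setT phi).
Local Notation C := R[i].
Local Notation A := (tatlas X).
Local Notation F := (fund (tatlas X) (trho X)).

Lemma muQ_diff_at (y : X) : diff_at A (muQ BQ) y.
Proof.
by apply: diff_at_mulmxr; apply: smooth_map_diff_at; exact: moment_smooth (tmu_moment X).
Qed.

Lemma fund_hamiltonian (y : X) :
  F y = - (dvec A (tmu X) y)^T *m invmx (tomega X y).
Proof.
rewrite -(moment_eq (tmu_moment X)) mulmxK //.
exact: form_nondegenerate (tomega_symplectic X) y.
Qed.

(** By the chain rule and the moment map equation, $X_{f\circ\mu_Q}$ is the fundamental field of
    $i_Q(\nabla f)$. It serves twice: for $\varphi$ itself and for the growth rates. *)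
Lemma ham_muQ (f : 'rV[R]_q -> R) (y : X) : differentiable f (muQ BQ y) ->
  ham (tomega X) (dfun A (f \o @muQ _ _ _ _ X BQ) y) y = grad f (muQ BQ y) *m intM R BQ *m F y.
Proof.
move=> df; rewrite /ham dfun_comp //; last exact: muQ_diff_at.
rewrite dvec_mulmxr; last by apply: smooth_map_diff_at; exact: moment_smooth (tmu_moment X).
by rewrite trmx_mul trmxK fund_hamiltonian !mulmxA !mulNmx !mulmxN !mulNmx.
Qed.

Definition flow_dir (y : X) : 'rV[R]_n := grad phi (muQ BQ y) *m intM R BQ.

Lemma X_varphiE (y : X) : X_varphi BQ phi y = flow_dir y *m F y.
Proof. exact: (ham_muQ (smooth_differentiable phi_smooth _)). Qed.

(** On a function of weight [w], $X_\varphi$ has the eigenvalue $i$ times this number. *)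
Definition growth (w : 'rV[R]_n) (y : X) : R := pairing (flow_dir y) w.

Lemma growthE (w : 'rV[R]_n) : growth w =
  (fun u => pairing (grad phi u) (w *m (intM R BQ)^T)) \o @muQ _ _ _ _ X BQ.
Proof. by apply/funext => y; rewrite /growth /flow_dir pairing_mulmx. Qed.

Lemma growth_invariant (w a : 'rV[R]_n) (y : X) : growth w (trho X a y) = growth w y.
Proof. by rewrite /growth /flow_dir /muQ (moment_invariant (tmu_moment X)). Qed.

Lemma growth_diff_at (w : 'rV[R]_n) (y : X) : diff_at A (growth w) y.
Proof.
rewrite growthE; apply: diff_at_comp; first exact: muQ_diff_at.
exact: pairing_grad_differentiable.
Qed.

Lemma ham_growth (w : 'rV[R]_n) (y : X) :
  ham (tomega X) (dfun A (growth w) y) y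
  = w *m (intM R BQ)^T *m hessian phi (muQ BQ y) *m intM R BQ *m F y.
Proof.
rewrite growthE ham_muQ; last exact: pairing_grad_differentiable.
by rewrite grad_pairing_grad.
Qed.

Section Slice.
Context {x : X} (S : slice_chart BK x).

Definition slice_weight (j : 'I_n) : 'rV[R]_n := intM R (row j (slice_wt S)).

Lemma ccoord_weight (j : 'I_n) (y : X) : cdom S y ->
  weight_fun (trho X) (slice_weight j) (ccoord S j) y.
Proof. by move=> Sy a; exact: slice_equivariant. Qed.

Lemma slice_diff_at (y : X) : cdom S y -> diff_at A S y.
Proof.
move=> Sy; have [cS _] := slice_holo S.
apply: ((cS _ (chart_at_atlas A y)).1 [::]).
by exists y => //; split => //; exact: mem_chart_at.
Qed.

Lemma ccoord_cdiff_at (j : 'I_n) (y : X) : cdom S y -> cdiff_at A (ccoord S j) y.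
Proof.
by move=> Sy; split; apply: (differentiable_entry (f := S \o _)); exact: slice_diff_at.
Qed.

Lemma near_slice (y : X) : cdom S y -> nbhs y (cdom S).
Proof. by move=> Sy; apply: open_nbhs_nbhs; split => //; exact: cdom_open. Qed.

Lemma growth_power_cdiff_at (w : 'rV[R]_n) r (y : X) :
  cdiff_at A (fun z => (0 +i* growth w z)%C ^+ r) y.
Proof.
elim: r => [|r ih]; first by split; exact: diff_at_cst.
under eq_fun do rewrite exprS.
by apply: cdiff_atM => //; split; [exact: diff_at_cst | exact: growth_diff_at].
Qed.

(** Since the growth rate is torus-invariant, $(ih)^rs_j$ has the same weight as $s_j$, and one more
    Lie derivative contributes one more factor $ih$. The induction runs over all points of the open
    slice domain, so its hypothesis can be differentiated. *)
Lemma iter_lieC (j : 'I_n) r (y : X) : cdom S y ->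
  iter r (lieC A (X_varphi BQ phi)) (ccoord S j) y
  = (0 +i* growth (slice_weight j) y)%C ^+ r * ccoord S j y.
Proof.
elim: r y => [|r ih] y Sy; first by rewrite expr0 mul1r.
pose g z := (0 +i* growth (slice_weight j) z)%C ^+ r * ccoord S j z.
rewrite iterS {1}/lieC (near_eq_dfunC A (g := g)); last first.
  by apply: filterS (near_slice Sy) => z; exact: ih.
rewrite -/(lieC A (X_varphi BQ phi) g y).
rewrite (lieC_weight (trho_action X) (w := slice_weight j) (X_varphiE y)).
- by rewrite /g exprS mulrA.
- by apply: cdiff_atM; [exact: growth_power_cdiff_at | exact: ccoord_cdiff_at].
- by move=> a; rewrite /g growth_invariant (ccoord_weight j Sy) mulrCA.
Qed.

Lemma imag_flow_ccoord (j : 'I_n) (t : R) (y : X) : cdom S y ->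
  imag_flow A (X_varphi BQ phi) t (ccoord S j) y
  = (expR (t * growth (slice_weight j) y))%:C%C * ccoord S j y.
Proof.
move=> Sy; set h := growth _ y; set z := ccoord S j y.
have mulE (c : R) : c%:C%C * z = (c * complex.Re z +i* (c * complex.Im z))%C.
  case: z => a b; apply/eqP; rewrite eq_complex /=.
  by apply/andP; split; apply/eqP; ring.
(* As $(-it)(ih)=th$, the partial sums are real exponential partial sums times the fixed number [z],
   so [limC] can be computed on each part. *)
have partial N : \sum_(0 <= r < N) (r`!%:R)^-1 * (- ('i * t%:C)%C) ^+ r *
    iter r (lieC A (X_varphi BQ phi)) (ccoord S j) y
    = (series (exp_coeff (t * h)) N)%:C%C * z.
  rewrite /series /= rmorph_sum /= mulr_suml; apply: eq_bigr => r _.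
  rewrite iter_lieC // -/h -/z !mulrA; congr (_ * _).
  rewrite -[LHS]mulrA -exprMn.
  have -> : - ('i * t%:C)%C * (0 +i* h)%C = (t * h)%:C%C.
    by apply/eqP; rewrite eq_complex /=; apply/andP; split; apply/eqP; ring.
  by rewrite mulrC -rmorphXn -(rmorph_nat (real_complex R)) -fmorphV -rmorphM.
have cvgE (c : R) : limn (fun N => series (exp_coeff (t * h)) N * c) = expR (t * h) * c.
  apply: cvg_lim => //; apply: cvgM; last exact: cvg_cst.
  exact: is_cvg_series_exp_coeff.
rewrite /imag_flow mulE -!cvgE /limC.
by congr (_ +i* _)%C; congr (limn _); apply/funext => N; rewrite partial mulE.
Qed.

(** The product rule for $e^{th}s_j$: differentiating the exponential produces the term $t s_j\,dh$,
    whose linear growth in $t$ drives the convergence. *)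
Lemma dfunC_imag_flow (j : 'I_n) (t : R) (y : X) : cdom S y ->
  dfunC A (imag_flow A (X_varphi BQ phi) t (ccoord S j)) y
  = (expR (t * growth (slice_weight j) y))%:C%C *:
    (dfunC A (ccoord S j) y
     + (t%:C%C * ccoord S j y) *: toC (dfun A (growth (slice_weight j)) y)).
Proof.
move=> Sy; set w := slice_weight j.
pose e z := expR (t * growth w z).
have dh := growth_diff_at w y.
have dth : diff_at A (fun z => t * growth w z) y.
  by apply: diff_atM => //; exact: diff_at_cst.
have de : diff_at A e y.
  apply: (diff_at_comp (g := expR) dth).
  by apply/derivable1_diffP; exact: derivable_expR.
have dfe : dfun A e y = e y *: (t *: dfun A (growth w) y).
  rewrite (dfun_comp_real (g := expR) dth); last exact: derivable_expR.
  have [_ ->] := is_derive_expR (t * growth w y); congr (_ *: _).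
  rewrite (dfunM (f := fun=> t)) //; last exact: diff_at_cst.
  suff -> : dfun A (fun=> t : R) y = 0 by rewrite scaler0 addr0.
  by apply/rowP => i; rewrite !mxE; exact: derive_cst.
have [d1 d2] := ccoord_cdiff_at j Sy.
rewrite (near_eq_dfunC A (g := fun z => (e z)%:C%C * ccoord S j z)); last first.
  by apply: filterS (near_slice Sy) => z; exact: imag_flow_ccoord.
have re_e : (fun z => complex.Re ((e z)%:C%C * ccoord S j z)) =
    fun z => e z * complex.Re (ccoord S j z).
  by apply/funext => z; case: (ccoord S j z) => a b /=; rewrite mul0r subr0.
have im_e : (fun z => complex.Im ((e z)%:C%C * ccoord S j z)) =
    fun z => e z * complex.Im (ccoord S j z).
  by apply/funext => z; case: (ccoord S j z) => a b /=; rewrite mul0r addr0.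
apply/rowP => i; rewrite /dfunC [LHS]mxE re_e im_e (dfunM de d1) (dfunM de d2) dfe !mxE -/(e y).
case: (ccoord S j y) => a b /=; apply/eqP; rewrite eq_complex /=.
by apply/andP; split; apply/eqP; ring.
Qed.

End Slice.
End Toric.

(** * The data of the linear problem at the point [x] *)

Section Assembly.
Context {R : realType} {n k q : nat} {P : set 'rV[R]_n} (X : toric_variety P).
Context (BK : 'M[int]_(k, n)) (BQ : 'M[int]_(q, n)) (phi : 'rV[R]_q -> R).
Context (phi_smooth : smooth_on setT phi).
Context (x : X) (S : slice_chart BK x).
Local Notation C := R[i].
Local Notation A := (tatlas X).
Local Notation F := (fund (tatlas X) (trho X) x).
Local Notation dS := (dvec (tatlas X) S x).
Local Notation W := (intM R (slice_wt S)).

Lemma slice_weightE (j : 'I_n) : slice_weight S j = row j W.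
Proof. by rewrite /slice_weight /intM map_row. Qed.

Lemma slice_dvec_unit : dS \in unitmx.
Proof.
have Sx := slice_mem S; have dS1 := slice_diff_at Sx.
set c := chart_at A x.
have cx : cdom c x by exact: mem_chart_at.
have dS2 : differentiable (c \o cinv S) (S x).
  have [cS _] := slice_holo S.
  apply: ((cS _ (chart_at_atlas A x)).2 [::]).
  by exists x.
pose B : 'M[R]_(n + n) := jacobian (c \o cinv S) (S x).
(* The candidate inverse is the Jacobian of the reverse transition map: the two transitions compose
   to the identity near the point. For square matrices a one-sided inverse suffices. *)
suff dSB : dS *m B = 1%:M by exact: (mulmx1_unit dSB).1.
rewrite /B.
apply/row_matrixP => i; rewrite !rowE mulmxA mulmx1.
rewrite -deriveEjacobian; last exact: dS2.
have dS2' : differentiable (c \o cinv S) ((S \o cinv c) (c x)) by rewrite /= chart_atK.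
rewrite -deriveEjacobian; last exact: dS1.
have := derive_comp (delta_mx 0 i) dS1 dS2'; rewrite /= chart_atK => <-.
rewrite -[RHS](derive_id (c x) (delta_mx 0 i)); apply: near_eq_derive.
have ncx : nbhs (c x) (c @` cdom c).
  apply: open_nbhs_nbhs; split; [exact: cimg_open | by exists x].
apply: filterS (filterI ncx (near_cinv A (near_slice Sx))) => u [[z cz <-]] /=; rewrite -/c.
by rewrite cmapK // => Sz; rewrite cmapK.
Qed.

Lemma row_ds_mx (j : 'I_n) : row j (ds_mx dS) = dfunC A (ccoord S j) x.
Proof.
apply/rowP => i; rewrite /dfunC /ds_mx !mxE /=.
have dS1 := slice_diff_at (slice_mem S).
have := dfun_entry (lshift n j) dS1; have := dfun_entry (rshift n j) dS1.
move=> /rowP/(_ i) h2 /rowP/(_ i) h1; rewrite !mxE in h1 h2.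
apply/eqP; rewrite eq_complex /= h1 h2.
by apply/andP; split; apply/eqP; ring.
Qed.

(** Infinitesimal equivariance of the slice coordinates, assembled for all coordinates at once in
    the form required by [F_dS]. *)
Lemma fund_dvec_slice : F *m dS =
  row_mx (W^T *m diag_mx (\row_j - complex.Im (ccoord S j x)))
         (W^T *m diag_mx (\row_j complex.Re (ccoord S j x))).
Proof.
have Sx := slice_mem S; have dS1 := slice_diff_at Sx.
have entry i l : (F *m dS) i l =
    pairing (basis_vec R i *m F) (dfun A (fun z => S z 0 l) x).
  rewrite dfun_entry // /pairing trmxK /basis_vec -rowE [LHS]mxE [RHS]mxE.
  by apply: eq_bigr => ? _; rewrite !mxE.
have pw (i j : 'I_n) : pairing (basis_vec R i) (slice_weight S j) = W^T i j.
  by rewrite slice_weightE /pairing /basis_vec -rowE !mxE.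
rewrite -[LHS]hsubmxK; congr row_mx; apply/matrixP => i j; rewrite mul_mx_diag !mxE.
  have [h _] := weight_dfun (trho_action X) (basis_vec R i)
    (ccoord_cdiff_at j Sx) (ccoord_weight j Sx).
  rewrite pw in h; have := entry i (lshift n j); rewrite [LHS]mxE => ->.
  by rewrite [LHS]h !mxE mulrN.
have [_ h] := weight_dfun (trho_action X) (basis_vec R i)
  (ccoord_cdiff_at j Sx) (ccoord_weight j Sx).
rewrite pw in h; have := entry i (rshift n j); rewrite [LHS]mxE => ->.
by rewrite [LHS]h !mxE.
Qed.

Lemma rank_fund : (n - stab_dim x)%N = \rank F.
Proof. by rewrite /stab_dim mxrank_ker subKn // rank_leq_row. Qed.

(** If the weight were nonzero on some basis vector of the Lie algebra of $K$, a suitable element of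
    $K$ would send $w_j(x)$ to $-w_j(x)$; invariance would then contradict $w_j(x)\ne0$. *)
Lemma subtorus_weight (j : 'I_n) : (orbit_dim BK x <= j)%N -> (j < \rank F)%N ->
  intM R BK *m col j W^T = 0.
Proof.
move=> pj; rewrite -rank_fund => jr; apply/colP => b; rewrite [RHS]mxE.
have Sx := slice_mem S.
set c := (_ *m _) b 0.
have cE : pairing (row b (intM R BK)) (slice_weight S j) = c.
  rewrite slice_weightE pairingE /c mxE; apply: eq_bigr => l _.
  by rewrite !mxE.
apply/eqP; apply: contraT => c0.
(* The scale [pi / c] makes the rotation angle exactly $\pi$. *)
pose a : 'rV[R]_k := (pi / c) *: delta_mx 0 b.
have := slice_K_invariant a Sx pj jr.
rewrite (slice_equivariant (s := S)) //=.
have -> : pairing (a *m intM R BK) (intM R (row j (slice_wt S))) = pi.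
  by rewrite /a -scalemxAl -rowE /pairing -scalemxAl mxE -/(pairing _ (slice_weight S j)) cE divfK.
rewrite cospi sinpi => h.
have := slice_nonzero Sx jr; rewrite -h => /negP[].
move: h; case: (ccoord S j x) => u v /= /eqP; rewrite eq_complex /= => /andP[/eqP h1 /eqP h2].
by rewrite eq_complex /=; apply/andP; split; apply/eqP; lra.
Qed.

Lemma hamC_imag_flow (t : R) (j : 'I_n) :
  hamC (tomega X) (dfunC A (imag_flow A (X_varphi BQ phi) t (ccoord S j)) x) x
  = (expR (t * growth BQ phi (slice_weight S j) x))%:C%C *:
    (row j (ham_mx (tomega X x) dS) + (t%:C%C * ccoord S j x) *:
      toC (row j (Xi_mx W (intM R BQ) (hessian phi (muQ BQ x))) *m F)).
Proof.
rewrite dfunC_imag_flow //; last exact: slice_mem.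
rewrite /hamC -scalerN -scalemxAl; congr (_ *: _).
rewrite opprD mulmxDl /ham_mx row_mul -row_ds_mx; congr (_ + _).
  by rewrite linearN.
rewrite -scalerN -scalemxAl; congr (_ *: _).
have := ham_growth BQ phi_smooth (slice_weight S j) x.
rewrite slice_weightE /Xi_mx !row_mul => <-.
by rewrite /ham toCM /toC map_invmx map_mxN.
Qed.

End Assembly.

(** Every standard basis vector is an integral combination of rows of [BK] and [BQ], so a covector
    vanishing on both families has all coordinates zero. *)
Lemma split_subtorus_span (R : realType) (n k q : nat) (BK : 'M[int]_(k, n))
    (BQ : 'M[int]_(q, n)) (w : 'rV[R]_n) : split_subtorus BK BQ ->
  w *m (intM R BK)^T = 0 -> w *m (intM R BQ)^T = 0 -> w = 0.
Proof.
move=> hB wK wQ; apply/rowP => i.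
have [[a b] [/= ab _]] := hB (delta_mx 0 i).
have abR : delta_mx 0 i = intM R a *m intM R BK + intM R b *m intM R BQ :> 'rV[R]_n.
  rewrite /intM -!map_mxM -map_mxD -ab; apply/rowP => l; rewrite !mxE.
  by case: (_ && _).
have : w *m (delta_mx 0 i : 'rV[R]_n)^T = 0.
  by rewrite abR linearD /= !trmx_mul mulmxDr !mulmxA wK wQ !mul0mx addr0.
by rewrite trmx_delta -colE => /colP/(_ 0); rewrite !mxE.
Qed.

Theorem theorem1p2 (R : realType) (n k q : nat) (P : set 'rV[R]_n)
    (hP : delzant P) (X : toric_variety P)
    (BK : 'M[int]_(k, n)) (BQ : 'M[int]_(q, n)) (hB : split_subtorus BK BQ)
    (phi : 'rV[R]_q -> R) (hphi : strictly_convex_smooth phi)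
    (x : X) (S : slice_chart BK x) :
  grass_cvg n (fun t : R => PKt BQ phi S t) (PR x).
Proof.
have [phi_smooth _ phi_pos] := hphi.
have [om_alt om_unit _ _] := tomega_symplectic X.
have [J_om _] := tJ_compatible X.
have [J_sqr _] := tJ_complex X.
have [_ S_holo] := slice_holo S.
(* The nonzero factors split off from the Hamiltonian vectors are the exponentials $e^{th_j(x)}$. *)
apply: (@frame_cvg R n k q (fund (tatlas X) (trho X) x) (tomega X x) (tJ X x)
  (dvec (tatlas X) S x) (intM R (slice_wt S)) (intM R BK) (intM R BQ)
  (hessian phi (muQ BQ x)) (fun j => ccoord S j x)
  _ _ _ _ _ _ _ _ _ _ _ (dvec (tatlas X) (tmu X) x) _
  (fun t j => (expR (t * growth BQ phi (slice_weight S j) x))%:C%C)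
  (fun t j => hamC (tomega X)
     (dfunC (tatlas X) (imag_flow (tatlas X) (X_varphi BQ phi) t (ccoord S j)) x) x)) => //.
- exact: slice_dvec_unit.
- exact: S_holo (slice_mem S).
- exact: fund_dvec_slice.
- by move=> j; rewrite -rank_fund => jr; apply: slice_nonzero jr; exact: slice_mem.
- by move=> j; rewrite -rank_fund; exact: slice_zero.
- exact: subtorus_weight.
- by move=> w; exact: (split_subtorus_span hB).
- by move=> v v0; rewrite hessianE //; exact: phi_pos.
- exact: moment_eq (tmu_moment X) x.
- by move=> t j; rewrite eq_complex /= eqxx andbT gt_eqF // expR_gt0.
- by move=> t j _; exact: hamC_imag_flow.
Qed.
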